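(* Let $R$ be a commutative ring with unit and let $G$, $H$ be countable discrete groups. If there exists an $H_{*,R}G$-full topologically free $(G,H)$ continuous orbit couple, then $\mathrm{hd}_R(G)\le\mathrm{hd}_R(H)$. If there exists an $H^{*,R}G$-full topologically free $(G,H)$ continuous orbit couple, then $\mathrm{cd}_R(G)\le\mathrm{cd}_R(H)$.
   Context: A topological dynamical system $G\curvearrowright X$ is an action by homeomorphisms on a locally compact Hausdorff space; it is topologically free if for all $g\ne e$ the set $\{x:g.x\ne x\}$ is dense. A continuous map $p:X\to Y$ is a continuous orbit map for $G\curvearrowright X$, $H\curvearrowright Y$ if there is a continuous $a:G\times X\to H$ with $p(g.x)=a(g,x).p(x)$ for all $g,x$. A $(G,H)$ continuous orbit couple consists of topological dynamical systems $G\curvearrowright X$, $H\curvearrowright Y$ and continuous orbit maps $p:X\to Y$, $q:Y\to X$ such that there are continuous $g:X\to G$, $h:Y\to H$ with $q(p(x))=g(x).x$, $p(q(y))=h(y).y$ for all $x,y$. It is topologically free if both systems are topologically free. A $G$-sheaf of $R$-modules over $X$ is a locally compact (Hausdorff) space $\mathcal A$ with an étale continuous surjection $\pi:\mathcal A\to X$ whose fibres are $R$-modules (with continuous operations), together with a left $G$-action on $\mathcal A$ by homeomorphisms such that $\pi$ is equivariant and $\mathcal A_x\to\mathcal A_{g.x}$, $a\mapsto g.a$, is an $R$-module isomorphism. $\Gamma(X,\mathcal A)$ (resp. $\Gamma_c(X,\mathcal A)$) is the $RG$-module of continuous sections (resp. with compact support), with $(g.f)(x)=g.f(g^{-1}.x)$.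 $\mathrm{hd}_R(G)$ (resp. $\mathrm{cd}_R(G)$) is the homological (resp. cohomological) dimension of $G$ over $R$: the supremum of all $n$ with $H_n(G,V)\ncong\{0\}$ (resp. $H^n(G,V)\ncong\{0\}$) for some $RG$-module $V$. A $(G,H)$ continuous orbit couple is $H_{*,R}G$-full if its system $G\curvearrowright X$ satisfies $\sup\{n:H_n(G,\Gamma_c(X,\mathcal A))\ncong\{0\}\}=\mathrm{hd}_R(G)$, and $H^{*,R}G$-full if $\sup\{n:H^n(G,\Gamma(X,\mathcal A))\ncong\{0\}\}=\mathrm{cd}_R(G)$, where the suprema are taken over all $n$ and all $G$-sheaves $\mathcal A$ of $R$-modules over $X$. *)

(* Defs.v *)
From HB Require Import structures.
From mathcomp Require Import all_boot all_order all_algebra finmap.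
From mathcomp Require Import generic_quotient ring_quotient.
From mathcomp Require Import all_classical all_reals topology ereal Rstruct.

Set Implicit Arguments.
Unset Strict Implicit.
Unset Printing Implicit Defensive.

Import GRing.Theory.
Local Open Scope classical_set_scope.
Local Open Scope ring_scope.
Local Open Scope quotient_scope.

Section Subquotient.
Context {R : pzRingType} {A B C : lmodType R}.
Variables (f : {linear A -> B}) (g : {linear B -> C}).

Definition ker_pred : {pred B} := [pred b | g b == 0].

Lemma ker_pred_closed : submod_closed ker_pred.
Proof.
split=> [|a u v]; first by rewrite inE linear0.
by rewrite !inE linearP => /eqP-> /eqP->; rewrite scaler0 addr0.
Qed.
HB.instance Definition _ := GRing.isSubmodClosed.Build R B ker_pred
  (GRing.submod_closed_semi ker_pred_closed).

Record kernel := Kernel { kernel_val :> B; _ : kernel_val \in ker_pred }.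
HB.instance Definition _ := [isSub for kernel_val].
HB.instance Definition _ := [Choice of kernel by <:].
HB.instance Definition _ := [SubChoice_isSubLmodule of kernel by <:].

Definition im_pred : {pred kernel} :=
  [pred z | `[< exists a, f a = kernel_val z >]].

Lemma im_pred_closed : submod_closed im_pred.
Proof.
split=> [|a u v]; first by apply/asboolP; exists 0; rewrite linear0.
move=> /asboolP[x xu] /asboolP[y yv]; apply/asboolP.
by exists (a *: x + y); rewrite linearP xu yv.
Qed.
HB.instance Definition _ := GRing.isSubmodClosed.Build R kernel im_pred
  (GRing.submod_closed_semi im_pred_closed).

(* [ker g / (im f `&` ker g)], that is, [ker g / im f] if [g \o f = 0]. *)
Definition subquotient : Type := Quotient.quot im_pred.
HB.instance Definition _ := GRing.Zmodule.on subquotient.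
HB.instance Definition _ := ZmodQuotient.on subquotient.

Definition subquotient_scale (r : R) (x : subquotient) : subquotient :=
  \pi_subquotient (r *: repr x).

Lemma subquotient_scaleE r (z : kernel) :
  subquotient_scale r (\pi_subquotient z) = \pi_subquotient (r *: z).
Proof.
apply/eqP; rewrite -Quotient.idealrBE -scalerBr rpredZ//.
by rewrite Quotient.idealrBE reprK.
Qed.

Lemma subquotient_scaleA r s x :
  subquotient_scale r (subquotient_scale s x) = subquotient_scale (r * s) x.
Proof.
by elim/quotW: x => x; rewrite (subquotient_scaleE s) !(subquotient_scaleE _ _) scalerA.
Qed.

Lemma subquotient_scale1 : left_id 1 subquotient_scale.
Proof. by move=> x; elim/quotW: x => x; rewrite subquotient_scaleE scale1r. Qed.

Lemma subquotient_scaleDr : right_distributive subquotient_scale +%R.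
Proof.
move=> r x y; elim/quotW: x => x; elim/quotW: y => y.
by rewrite -raddfD !subquotient_scaleE scalerDr raddfD.
Qed.

Lemma subquotient_scaleDl x : {morph subquotient_scale^~ x : r s / r + s}.
Proof.
move=> r s; elim/quotW: x => x.
by rewrite !subquotient_scaleE scalerDl raddfD.
Qed.
HB.instance Definition _ := GRing.Zmodule_isLmodule.Build R subquotient
  subquotient_scaleA subquotient_scale1 subquotient_scaleDr subquotient_scaleDl.

End Subquotient.

Section FinitelySupported.
Context {R : pzRingType}.
Variables (T : choiceType) (V : lmodType R).

Definition fin_pred : {pred T -> V} :=
  [pred f : T -> V | `[< finite_set [set x | f x <> 0] >]].

Lemma fin_pred_closed : submod_closed fin_pred.
Proof.
split=> [|a u v /asboolP fu /asboolP fv]; apply/asboolP.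
  by rewrite [X in finite_set X](_ : _ = set0)// -subset0 => x /=.
apply: (@sub_finite_set _ _ ([set x | u x <> 0] `|` [set x | v x <> 0])).
  move=> x /= axy; have [ux|] := eqVneq (u x) 0; last by move/eqP; left.
  right=> vx; apply: axy; transitivity (a *: u x + v x) => //.
  by rewrite ux vx scaler0 addr0.
by rewrite finite_setU.
Qed.
HB.instance Definition _ := GRing.isSubmodClosed.Build R (T -> V) fin_pred
  (GRing.submod_closed_semi fin_pred_closed).

Record finfunc := FinFunc { finfunc_val :> T -> V; _ : finfunc_val \in fin_pred }.
HB.instance Definition _ := [isSub for finfunc_val].
HB.instance Definition _ := [Choice of finfunc by <:].
HB.instance Definition _ := [SubChoice_isSubLmodule of finfunc by <:].

Lemma finfuncP (f : finfunc) : finite_set [set x | f x <> 0].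
Proof. by have /asboolP := valP f. Qed.

Lemma fsum_supp (D S : set T) (f : T -> V) :
    finite_set S -> [set x | f x <> 0] `<=` S ->
  \sum_(x \in D) f x = \sum_(x <- fset_set S) (if x \in D then f x else 0).
Proof.
move=> finS fS; rewrite fsbig_mkcond -(fsbig_widen S)//.
  exact: fsbig_finite.
move=> x [_ Sx]; rewrite /= /patch; case: ifP => // _.
by apply: contra_notP Sx; exact: fS.
Qed.

End FinitelySupported.

Section GroupHomology.
Variables (R : comPzRingType) (G : groupType).

(* A left RG-module, as an R-module with an R-linear action of G. *)
Record gmodule := GModule {
  gmod_sort :> lmodType R;
  gmod_act : G -> gmod_sort -> gmod_sort;
  gmod_act_linear : forall g, linear (gmod_act g);
  gmod_act1 : forall v, gmod_act 1%g v = v;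
  gmod_actM : forall g h v, gmod_act (g * h)%g v = gmod_act g (gmod_act h v)
}.

(* The i-th face of the nerve of G: with u = (g_1, ..., g_{n+1}), it is
   (g_2, ..., g_{n+1}) for i = 0, (g_1, ..., g_i g_{i+1}, ..., g_{n+1}) for
   0 < i < n + 1, and (g_1, ..., g_n) for i = n + 1. *)
Definition face n (i : 'I_n.+2) (u : n.+1.-tuple G) : n.-tuple G :=
  [tuple let a := tnth u (widen_ord (leqnSn n) j) in
         let b := tnth u (lift ord0 j) in
         if (j.+1 < i)%N then a
         else if j.+1 == i :> nat then (a * b)%g else b | j < n].

Variable V : gmodule.

Definition chain n := finfunc (n.-tuple G) V.
HB.instance Definition _ n := GRing.Lmodule.on (chain n).

(* The boundary of the bar complex, V being regarded as a right G-module via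
   v.g = g^-1.v; an element f of [chain n] stands for the sum over u of
   f(u) (x) u. *)
Definition boundary_fun n (f : n.+1.-tuple G -> V) (t : n.-tuple G) : V :=
  \sum_(i < n.+2) (-1) ^+ i *:
    \sum_(u \in face i @^-1` [set t])
       (if i == ord0 then gmod_act (thead u)^-1%g (f u) else f u).

Lemma gmod_act0 (M : gmodule) g : gmod_act g (0 : M) = 0.
Proof.
have := gmod_act_linear g (-1) (0 : M) 0.
by rewrite scaler0 addr0 scaleN1r addNr.
Qed.

Lemma boundary_fin n (f : chain n.+1) : boundary_fun f \in @fin_pred R (n.-tuple G) V.
Proof.
apply/asboolP.
apply: (@sub_finite_set _ _ (\bigcup_(i in [set: 'I_n.+2])
    (face i @` [set u | f u <> 0]))); last first.
  apply: bigcup_finite => // i _; apply: finite_image; exact: finfuncP.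
move=> t /= tN; apply: contrapT => tN'; apply: tN.
rewrite /boundary_fun big1// => i _; rewrite fsbig1 ?scaler0// => u /= ut.
have fu : f u = 0.
  by apply: contrapT => fu; apply: tN'; exists i => //; exists u.
by rewrite fu gmod_act0; case: ifP.
Qed.

Definition boundary n (f : chain n.+1) : chain n := FinFunc (boundary_fin f).

Lemma boundary_linear n : linear (@boundary n).
Proof.
move=> a f h; apply: val_inj; apply/funext => t.
transitivity (a *: boundary_fun f t + boundary_fun h t) => //.
pose S := [set u | f u <> 0] `|` [set u | h u <> 0].
have finS : finite_set S by rewrite finite_setU; split; exact: finfuncP.
rewrite /= /boundary_fun scaler_sumr -big_split; apply: eq_bigr => i _ /=.
rewrite scalerA mulrC -scalerA -scalerDr; congr (_ *: _).
rewrite !(@fsum_supp _ _ _ _ S)//.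
- rewrite scaler_sumr -big_split; apply: eq_bigr => u _ /=.
  case: ifP => _; last by rewrite scaler0 addr0.
  by case: ifP => // _; exact: gmod_act_linear.
- move=> u /= hu; right => h0; apply: hu; rewrite h0 gmod_act0; by case: ifP.
- move=> u /= hu; left => h0; apply: hu; rewrite h0 gmod_act0; by case: ifP.
- move=> u /= hu; apply: contrapT => /not_orP[/contrapT fu /contrapT hu0].
  apply: hu; transitivity
    (if i == ord0 then gmod_act (thead u)^-1%g (a *: f u + h u)
     else a *: f u + h u) => //.
  by rewrite fu hu0 scaler0 addr0 gmod_act0; case: ifP.
Qed.
HB.instance Definition _ n :=
  GRing.isLinear.Build R (chain n.+1) (chain n) *:%R (@boundary n)
    (@boundary_linear n).

Definition group_homology n : lmodType R :=
  if n is m.+1 then subquotient (@boundary m.+1) (@boundary m)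
  else subquotient (@boundary 0) (\0 : {linear chain 0 -> chain 0}).

Definition cochain n := n.-tuple G -> V.
HB.instance Definition _ n := GRing.Lmodule.on (cochain n).

Definition coboundary n (f : cochain n) : cochain n.+1 := fun u =>
  \sum_(i < n.+2) (-1) ^+ i *:
    (if i == ord0 then gmod_act (thead u) (f (face i u)) else f (face i u)).

Lemma coboundary_linear n : linear (@coboundary n).
Proof.
move=> a f h; apply/funext => u.
transitivity (a *: coboundary f u + coboundary h u) => //.
rewrite /coboundary scaler_sumr -big_split; apply: eq_bigr => i _ /=.
rewrite scalerA mulrC -scalerA -scalerDr; congr (_ *: _).
by case: ifP => // _; exact: gmod_act_linear.
Qed.
HB.instance Definition _ n :=
  GRing.isLinear.Build R (cochain n) (cochain n.+1) *:%R (@coboundary n)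
    (@coboundary_linear n).

Definition group_cohomology n : lmodType R :=
  if n is m.+1 then subquotient (@coboundary m) (@coboundary m.+1)
  else subquotient (\0 : {linear cochain 0 -> cochain 0}) (@coboundary 0).

End GroupHomology.

Definition nonzero_module (R : pzRingType) (M : lmodType R) : Prop :=
  exists x : M, x <> 0.

(* With values in the extended reals, so that the supremum of the empty set
   is -oo and that of an unbounded set is +oo. *)
Definition degree_sup (D : set nat) : \bar Rdefinitions.R :=
  ereal_sup [set (n%:R)%:E | n in D].

Definition hd (R : comPzRingType) (G : groupType) : \bar Rdefinitions.R :=
  degree_sup [set n | exists V : gmodule R G,
                        nonzero_module (group_homology V n)].

Definition cd (R : comPzRingType) (G : groupType) : \bar Rdefinitions.R :=
  degree_sup [set n | exists V : gmodule R G,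
                        nonzero_module (group_cohomology V n)].

Record tds (G : groupType) := TDS {
  tds_space :> topologicalType;
  tds_hausdorff : hausdorff_space tds_space;
  tds_locally_compact : locally_compact [set: tds_space];
  tds_act : G -> tds_space -> tds_space;
  tds_act1 : forall x, tds_act 1%g x = x;
  tds_actM : forall g h x, tds_act (g * h)%g x = tds_act g (tds_act h x);
  (* each g acts by a homeomorphism, the inverse being the action of g^-1 *)
  tds_act_continuous : forall g, continuous (tds_act g)
}.

Definition topologically_free (G : groupType) (X : tds G) : Prop :=
  forall g : G, g <> 1%g -> dense [set x : X | tds_act g x <> x].

Definition continuous_orbit_map (G H : groupType) (X : tds G) (Y : tds H)
    (p : X -> Y) : Prop :=
  continuous p /\
  exists a : discrete_topology G * X -> discrete_topology H,
    continuous a /\ forall g x, p (tds_act g x) = tds_act (a (g, x)) (p x).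

Record orbit_couple (G H : groupType) := OrbitCouple {
  oc_X : tds G;
  oc_Y : tds H;
  oc_p : oc_X -> oc_Y;
  oc_q : oc_Y -> oc_X;
  oc_p_orbit : continuous_orbit_map oc_p;
  oc_q_orbit : continuous_orbit_map oc_q;
  oc_qp : exists g : oc_X -> discrete_topology G,
    continuous g /\ forall x, oc_q (oc_p x) = tds_act (g x) x;
  oc_pq : exists h : oc_Y -> discrete_topology H,
    continuous h /\ forall y, oc_p (oc_q y) = tds_act (h y) y
}.

Definition topologically_free_couple (G H : groupType)
    (c : orbit_couple G H) : Prop :=
  topologically_free (oc_X c) /\ topologically_free (oc_Y c).

(* A continuous map restricting to homeomorphisms from open neighbourhoods of
   the points of its domain onto open sets; s is the inverse of p on U. *)
Definition etale_map (E X : topologicalType) (p : E -> X) : Prop :=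
  continuous p /\
  forall a : E, exists U : set E,
    [/\ open U, U a, open (p @` U) &
        exists s : X -> E, {within p @` U, continuous s} /\
                           forall b, U b -> s (p b) = b].

(* The module operations on the fibres are gathered into operations on the
   total space; those are only meaningful (and only constrained) on arguments
   lying over the same point. *)
Record gsheaf (R : comPzRingType) (G : groupType) (X : tds G) := GSheaf {
  sh_space :> topologicalType;
  sh_hausdorff : hausdorff_space sh_space;
  sh_locally_compact : locally_compact [set: sh_space];
  sh_pi : sh_space -> X;
  sh_etale : etale_map sh_pi;
  sh_surjective : forall x, exists a, sh_pi a = x;
  sh_zero : X -> sh_space;
  sh_opp : sh_space -> sh_space;
  sh_add : sh_space -> sh_space -> sh_space;
  sh_scale : R -> sh_space -> sh_space;
  sh_pi_zero : forall x, sh_pi (sh_zero x) = x;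
  sh_pi_opp : forall a, sh_pi (sh_opp a) = sh_pi a;
  sh_pi_add : forall a b, sh_pi a = sh_pi b -> sh_pi (sh_add a b) = sh_pi a;
  sh_pi_scale : forall r a, sh_pi (sh_scale r a) = sh_pi a;
  sh_addA : forall a b c, sh_pi a = sh_pi b -> sh_pi b = sh_pi c ->
    sh_add a (sh_add b c) = sh_add (sh_add a b) c;
  sh_addC : forall a b, sh_pi a = sh_pi b -> sh_add a b = sh_add b a;
  sh_add0 : forall a, sh_add (sh_zero (sh_pi a)) a = a;
  sh_addN : forall a, sh_add (sh_opp a) a = sh_zero (sh_pi a);
  sh_scaleA : forall r s a, sh_scale r (sh_scale s a) = sh_scale (r * s) a;
  sh_scale1 : forall a, sh_scale 1 a = a;
  sh_scaleDr : forall r a b, sh_pi a = sh_pi b ->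
    sh_scale r (sh_add a b) = sh_add (sh_scale r a) (sh_scale r b);
  sh_scaleDl : forall r s a,
    sh_scale (r + s) a = sh_add (sh_scale r a) (sh_scale s a);
  sh_zero_continuous : continuous sh_zero;
  sh_opp_continuous : continuous sh_opp;
  sh_add_continuous :
    {within [set ab : sh_space * sh_space | sh_pi ab.1 = sh_pi ab.2],
      continuous (fun ab => sh_add ab.1 ab.2)};
  sh_scale_continuous : forall r, continuous (sh_scale r);
  sh_act : G -> sh_space -> sh_space;
  sh_act1 : forall a, sh_act 1%g a = a;
  sh_actM : forall g h a, sh_act (g * h)%g a = sh_act g (sh_act h a);
  sh_act_continuous : forall g, continuous (sh_act g);
  sh_pi_act : forall g a, sh_pi (sh_act g a) = tds_act g (sh_pi a);
  sh_act_add : forall g a b, sh_pi a = sh_pi b ->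
    sh_act g (sh_add a b) = sh_add (sh_act g a) (sh_act g b);
  sh_act_scale : forall g r a,
    sh_act g (sh_scale r a) = sh_scale r (sh_act g a)
}.

Section Sections.
Context {R : comPzRingType} {G : groupType} {X : tds G}.
Variable A : gsheaf R X.

Definition section_pred : {pred X -> A} :=
  [pred s : X -> A | `[< continuous s /\ forall x, sh_pi (s x) = x >]].

Record section := Section_ { section_val :> X -> A; _ : section_val \in section_pred }.
HB.instance Definition _ := [isSub for section_val].
HB.instance Definition _ := [Choice of section by <:].

Lemma section_continuous (s : section) : continuous s.
Proof. by have /asboolP[] := valP s. Qed.

Lemma sectionK (s : section) x : sh_pi (s x) = x.
Proof. by have /asboolP[_] := valP s; apply. Qed.

Lemma section_ext (s t : section) : s =1 t -> s = t.
Proof. by move=> st; apply: val_inj; apply/funext. Qed.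

Lemma section0_subproof : (@sh_zero _ _ _ A) \in section_pred.
Proof.
apply/asboolP; split; [exact: sh_zero_continuous|exact: sh_pi_zero].
Qed.
Definition section0 := Section_ section0_subproof.

Lemma sectionN_subproof (s : section) : (fun x => sh_opp (s x)) \in section_pred.
Proof.
apply/asboolP; split=> x; last by rewrite sh_pi_opp sectionK.
apply: (@continuous_comp _ _ _ s (@sh_opp _ _ _ A)).
  exact: section_continuous.
exact: sh_opp_continuous.
Qed.
Definition sectionN s := Section_ (sectionN_subproof s).

Lemma sectionD_subproof (s t : section) :
  (fun x => sh_add (s x) (t x)) \in section_pred.
Proof.
apply/asboolP; split=> x; last by rewrite sh_pi_add ?sectionK.
have /subspace_continuousP/(_ (s x, t x)) := @sh_add_continuous _ _ _ A.
rewrite /= !sectionK => /(_ erefl) addc.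
apply: (@cvg_trans _ ((fun ab : A * A => sh_add ab.1 ab.2) @
  within [set ab : A * A | sh_pi ab.1 = sh_pi ab.2] (nbhs (s x, t x)))) => //.
move=> W /= W1.
have st : (fun y => (s y, t y)) @ x --> (s x, t x).
  by apply: cvg_pair => /=; exact: section_continuous.
have := st _ W1; rewrite /nbhs /=; apply: filterS => y /=.
by apply; rewrite !sectionK.
Qed.
Definition sectionD s t := Section_ (sectionD_subproof s t).

Lemma sectionZ_subproof r (s : section) :
  (fun x => sh_scale r (s x)) \in section_pred.
Proof.
apply/asboolP; split=> x; last by rewrite sh_pi_scale sectionK.
apply: (@continuous_comp _ _ _ s (@sh_scale _ _ _ A r)).
  exact: section_continuous.
exact: sh_scale_continuous.
Qed.
Definition sectionZ r s := Section_ (sectionZ_subproof r s).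

Lemma sectionDA : associative sectionD.
Proof. by move=> s t u; apply: section_ext => x /=; rewrite sh_addA ?sectionK. Qed.

Lemma sectionDC : commutative sectionD.
Proof. by move=> s t; apply: section_ext => x /=; rewrite sh_addC ?sectionK. Qed.

Lemma section0D : left_id section0 sectionD.
Proof.
move=> s; apply: section_ext => x /=.
by rewrite -{1}(sectionK s x) sh_add0.
Qed.

Lemma sectionND : left_inverse section0 sectionN sectionD.
Proof. by move=> s; apply: section_ext => x /=; rewrite sh_addN sectionK. Qed.

HB.instance Definition _ :=
  GRing.isZmodule.Build section sectionDA sectionDC section0D sectionND.

Lemma sectionZA r r' s : sectionZ r (sectionZ r' s) = sectionZ (r * r') s.
Proof. by apply: section_ext => x /=; rewrite sh_scaleA. Qed.

Lemma sectionZ1 : left_id 1 sectionZ.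
Proof. by move=> s; apply: section_ext => x /=; rewrite sh_scale1. Qed.

Lemma sectionZDr : right_distributive sectionZ +%R.
Proof.
by move=> r s t; apply: section_ext => x /=; rewrite sh_scaleDr ?sectionK.
Qed.

Lemma sectionZDl s : {morph sectionZ^~ s : r r' / r + r'}.
Proof. by move=> r r'; apply: section_ext => x /=; rewrite sh_scaleDl. Qed.

HB.instance Definition _ := GRing.Zmodule_isLmodule.Build R section
  sectionZA sectionZ1 sectionZDr sectionZDl.

Lemma section_act_subproof g (s : section) :
  (fun x => sh_act g (s (tds_act g^-1%g x))) \in section_pred.
Proof.
apply/asboolP; split=> x; last first.
  by rewrite sh_pi_act sectionK -tds_actM mulgV tds_act1.
apply: (@continuous_comp _ _ _ (tds_act g^-1%g) (fun y => sh_act g (s y))).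
  exact: tds_act_continuous.
apply: (@continuous_comp _ _ _ s (@sh_act _ _ _ A g)).
  exact: section_continuous.
exact: sh_act_continuous.
Qed.
Definition section_act g s := Section_ (section_act_subproof g s).

Lemma section_act_linear g : linear (section_act g).
Proof.
move=> r s t; apply: section_ext => x /=.
by rewrite sh_act_add ?sh_pi_scale ?sectionK// sh_act_scale.
Qed.

Lemma section_act1 s : section_act 1%g s = s.
Proof. by apply: section_ext => x /=; rewrite invg1 tds_act1 sh_act1. Qed.

Lemma section_actM g h s :
  section_act (g * h)%g s = section_act g (section_act h s).
Proof. by apply: section_ext => x /=; rewrite invgM tds_actM sh_actM. Qed.

Definition Gamma : gmodule R G :=
  GModule section_act_linear section_act1 section_actM.

Definition csection_pred : {pred section} :=
  [pred s : section | `[< compact (closure [set x | s x <> sh_zero A x]) >]].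

Lemma csection_pred_closed : submod_closed csection_pred.
Proof.
split=> [|r s t /asboolP sc /asboolP tc]; apply/asboolP.
  rewrite (_ : [set x | _] = set0) ?closure0; first exact: compact0.
  by rewrite -subset0 => x /=.
apply: (subclosed_compact _ (compactU sc tc)); first exact: closed_closure.
rewrite -closureU; apply: closureS => x /= stN.
apply: contrapT => /not_orP[/contrapT sx /contrapT tx]; apply: stN.
have r0 : sh_scale r (sh_zero A x) = sh_zero A x.
  by have := congr1 (fun u : section => u x) (scaler0 section r).
by rewrite /= sx tx r0 -{1}(sh_pi_zero A x) sh_add0.
Qed.
HB.instance Definition _ := GRing.isSubmodClosed.Build R section csection_pred
  (GRing.submod_closed_semi csection_pred_closed).

Record csection := CSection { csection_val :> section; _ : csection_val \in csection_pred }.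
HB.instance Definition _ := [isSub for csection_val].
HB.instance Definition _ := [Choice of csection by <:].
HB.instance Definition _ := [SubChoice_isSubLmodule of csection by <:].

Lemma csection_act_subproof g (s : csection) :
  section_act g (csection_val s) \in csection_pred.
Proof.
apply/asboolP; have /asboolP sc := valP s.
set K := closure _ in sc.
apply: (@subclosed_compact _ _ (tds_act g @` K)).
- exact: closed_closure.
- apply: continuous_compact => //.
  by apply: continuous_subspaceT; exact: tds_act_continuous.
have -> : tds_act g @` K = tds_act g^-1%g @^-1` K.
  apply/seteqP; split=> [_ [x Kx <-]|x Kx] /=.
    by rewrite -tds_actM mulVg tds_act1.
  by exists (tds_act g^-1%g x) => //; rewrite -tds_actM mulgV tds_act1.
have /closure_id -> : closed (tds_act g^-1%g @^-1` K).
  apply: closed_comp; last exact: closed_closure.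
  by move=> x _; exact: tds_act_continuous.
apply: closureS => x /= gsx; apply: subset_closure => /= sx; apply: gsx.
rewrite sx; set y := tds_act _ _.
have g0 : section_act g 0 = 0 :> section.
  have := section_act_linear g (-1) (0 : section) 0.
  by rewrite scaler0 addr0 scaleN1r addNr.
by have := congr1 (fun u : section => u x) g0.
Qed.
Definition csection_act g s := CSection (csection_act_subproof g s).

Lemma csection_act_linear g : linear (csection_act g).
Proof. by move=> r s t; apply: val_inj => /=; exact: section_act_linear. Qed.

Lemma csection_act1 s : csection_act 1%g s = s.
Proof. by apply: val_inj => /=; exact: section_act1. Qed.

Lemma csection_actM g h s :
  csection_act (g * h)%g s = csection_act g (csection_act h s).
Proof. by apply: val_inj => /=; exact: section_actM. Qed.

Definition Gamma_c : gmodule R G :=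
  GModule csection_act_linear csection_act1 csection_actM.

End Sections.

Definition homology_full (R : comPzRingType) (G H : groupType)
    (c : orbit_couple G H) : Prop :=
  degree_sup [set n | exists A : gsheaf R (oc_X c),
                        nonzero_module (group_homology (Gamma_c A) n)]
  = hd R G.

Definition cohomology_full (R : comPzRingType) (G H : groupType)
    (c : orbit_couple G H) : Prop :=
  degree_sup [set n | exists A : gsheaf R (oc_X c),
                        nonzero_module (group_cohomology (Gamma A) n)]
  = cd R G.

(* Main.v *)
Require Import Defs.
From HB Require Import structures.
From mathcomp Require Import all_boot all_order all_algebra finmap.
From mathcomp Require Import generic_quotient ring_quotient zify.
From mathcomp Require Import all_classical all_reals topology ereal Rstruct.

(* Let a : G x X -> H be the cocycle of the orbit map p. Topological freeness of
   Y makes it a cocycle, so that G acts on Z = X x H by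
   g.(x, h) = (g.x, a(g, x) h), commuting with the action of H by right
   translations on the second factor. Then Z -> X is a trivial H-bundle, while
   q and topological freeness of X provide a continuous G-equivariant map
   d : Z -> G, that is, a trivialization of Z as a G-space.

   Let N be the module of compactly supported sections over Z of the pullback
   of a G-sheaf A. Cutting sections along the fibres of d, or of Z -> H, shows
   that N is relatively projective over G as well as over H, hence acyclic for
   both. As N_H is the module of compactly supported sections of A, the double
   complex of bar chains of G and H in N yields
   H_n(G, Gamma_c(X, A)) = H_n(H, N_G). Dually, the module of all sections over Z
   is relatively injective over both groups, and its H-invariants are
   Gamma(X, A). *)

Set Implicit Arguments.
Unset Strict Implicit.
Unset Printing Implicit Defensive.

Import GRing.Theory.
Local Open Scope classical_set_scope.
Local Open Scope ring_scope.
Local Open Scope quotient_scope.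

(** * Double complexes with exact rows and columns *)

(** As [hd R H] and [cd R H] range over all modules, it suffices that nonvanishing in a single
    degree passes from G to some H-module. The receiving module is the abstract module of
    G-(co)invariants of N, with no sheaf on Y behind it. So neither an isomorphism nor a spectral
    sequence is built: a zigzag in a double complex with commuting differentials carries exactness
    in one fixed degree. Acyclicity cannot come from projectivity or injectivity, since the fibres
    of the sheaf are arbitrary R-modules. Cutting (dually, evaluating) along a trivialization
    instead gives explicit contracting homotopies of the bar complexes. The topological obstacle is
    that p is not assumed open, so an element of H fixing p(y) for all y near x is not yet known to
    fix an open set of Y. Going round through q repairs this, because p o q is locally a
    translation. The map d comes from the point q(h^-1.p(x)). It lies in the G-orbit of x and does
    not change when G acts on (x, h); d(h, x) is the element, read off from the cocycles, that
    carries it back to x. *)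

Section DoubleComplexHomology.
Variables (C : nat -> nat -> zmodType) (E F : nat -> zmodType).
Variables (d1 : forall i j, {additive C i.+1 j -> C i j}).
Variables (d2 : forall i j, {additive C i j.+1 -> C i j}).
Variables (dE : forall i, {additive E i.+1 -> E i}).
Variables (dF : forall j, {additive F j.+1 -> F j}).
Variables (eps : forall i, {additive C i 0%N -> E i}).
Variables (phi : forall j, {additive C 0%N j -> F j}).

Hypothesis d1d2 : forall i j x, d1 i j (d2 i.+1 j x) = d2 i j (d1 i j.+1 x).
Hypothesis d1d1 : forall i j x, d1 i j (d1 i.+1 j x) = 0.
Hypothesis d2d2 : forall i j x, d2 i j (d2 i j.+1 x) = 0.
Hypothesis eps_d1 : forall i x, eps i (d1 i 0%N x) = dE i (eps i.+1 x).
Hypothesis phi_d2 : forall j x, phi j (d2 0%N j x) = dF j (phi j.+1 x).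
Hypothesis eps_d2 : forall i x, eps i (d2 i 0%N x) = 0.
Hypothesis phi_d1 : forall j x, phi j (d1 0%N j x) = 0.
Hypothesis eps_surj : forall i z, exists x, eps i x = z.
Hypothesis phi_surj : forall j z, exists x, phi j x = z.
Hypothesis row_exact : forall i j x, d2 i j x = 0 -> exists y, d2 i j.+1 y = x.
Hypothesis row_exact0 : forall i x, eps i x = 0 -> exists y, d2 i 0%N y = x.
Hypothesis col_exact : forall i j x, d1 i j x = 0 -> exists y, d1 i.+1 j y = x.
Hypothesis col_exact0 : forall j x, phi j x = 0 -> exists y, d1 0%N j y = x.

Definition row_cycle i j : C i j -> Prop :=
  if j is j'.+1 then fun x => d2 i j' x = 0 else fun x => eps i x = 0.

Definition edge_cycle (D : nat -> zmodType)
    (d : forall i, {additive D i.+1 -> D i}) i : D i -> Prop :=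
  if i is i'.+1 then fun x => d i' x = 0 else fun=> True.

(** The condition that the zigzag preserves: [d1 u] lifts along the augmented row; in column 0 the
    zigzag leaves the double complex and ends in F. *)
Definition diagonal_cycle i j : C i j -> Prop :=
  if i is i'.+1 then fun x => row_cycle (d1 i' j x)
  else fun x => edge_cycle dF (phi j x).

Lemma row_cycleP i j (x : C i j) : row_cycle x -> exists y, d2 i j y = x.
Proof. by case: j x => [|j] x /=; [exact: row_exact0|exact: row_exact]. Qed.

(** Zigzag along the antidiagonal towards i = 0, where the vanishing for F enters. Row exactness
    lifts [d1 u] to [u'] at (i - 1, j + 1); a splitting of [u'] corrects [u] by [d2 v] to a
    [d1]-cycle, and column exactness finishes. *)
Lemma diagonal_split i j (u : C i j) :
  (forall z, edge_cycle dF z -> exists w, dF (i + j)%N w = z) ->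
  diagonal_cycle u -> exists v w, u = d1 i j v + d2 i j w.
Proof.
elim: i j u => [|i IH] j u HF /= cu.
  have [w /= wu] := HF _ cu; have [x xw] := phi_surj w.
  have /col_exact0[v vE] : phi j (u - d2 0%N j x) = 0.
    by rewrite raddfB phi_d2 xw wu subrr.
  by exists v, x; rewrite vE subrK.
have [u' u'E] := row_cycleP cu.
have {}HF : forall z, edge_cycle dF z -> exists w, dF (i + j.+1)%N w = z.
  by rewrite addnS; exact: HF.
have /(IH _ _ HF)[v [w vw]] : diagonal_cycle u'.
  case: i {IH HF} u u' cu u'E => [|i] u u' cu u'E /=.
    by rewrite -phi_d2 u'E phi_d1.
  by rewrite -d1d2 u'E d1d1.
have /col_exact[w' w'E] : d1 i j (u - d2 i.+1 j v) = 0.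
  by rewrite raddfB -u'E vw raddfD /= d1d2 d2d2 addr0 subrr.
by exists w', v; rewrite w'E subrK.
Qed.

Lemma double_complex_homology n :
  (forall z, edge_cycle dF z -> exists w, dF n w = z) ->
  (forall z, edge_cycle dE z -> exists w, dE n w = z).
Proof.
move=> HF z cz; have [u uz] := eps_surj z.
have [||v [w uvw]] := @diagonal_split n 0%N u.
- by rewrite addn0.
- case: n HF z cz u uz => [|n] HF z cz u uz /=; first by [].
  by rewrite eps_d1 uz.
by exists (eps _ v); rewrite -eps_d1 -uz uvw raddfD /= eps_d2 addr0.
Qed.

End DoubleComplexHomology.

(** * The dual zigzag, for cochain complexes *)

Section DoubleComplexCohomology.
Variables (C : nat -> nat -> zmodType) (E F : nat -> zmodType).
Variables (d1 : forall i j, {additive C i j -> C i.+1 j}).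
Variables (d2 : forall i j, {additive C i j -> C i j.+1}).
Variables (dE : forall i, {additive E i -> E i.+1}).
Variables (dF : forall j, {additive F j -> F j.+1}).
Variables (eta : forall i, {additive E i -> C i 0%N}).
Variables (theta : forall j, {additive F j -> C 0%N j}).

Hypothesis d1d2 : forall i j x, d1 i j.+1 (d2 i j x) = d2 i.+1 j (d1 i j x).
Hypothesis d1d1 : forall i j x, d1 i.+1 j (d1 i j x) = 0.
Hypothesis d2d2 : forall i j x, d2 i j.+1 (d2 i j x) = 0.
Hypothesis d1_eta : forall i x, d1 i 0%N (eta i x) = eta i.+1 (dE i x).
Hypothesis d2_theta : forall j x, d2 0%N j (theta j x) = theta j.+1 (dF j x).
Hypothesis d2_eta : forall i x, d2 i 0%N (eta i x) = 0.
Hypothesis d1_theta : forall j x, d1 0%N j (theta j x) = 0.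
Hypothesis eta_inj : forall i x, eta i x = 0 -> x = 0.
Hypothesis theta_inj : forall j x, theta j x = 0 -> x = 0.
Hypothesis row_exact : forall i j x,
  d2 i j.+1 x = 0 -> exists y, d2 i j y = x.
Hypothesis row_exact0 : forall i x, d2 i 0%N x = 0 -> exists y, eta i y = x.
Hypothesis col_exact : forall i j x,
  d1 i.+1 j x = 0 -> exists y, d1 i j y = x.
Hypothesis col_exact0 : forall j x, d1 0%N j x = 0 -> exists y, theta j y = x.

Definition row_boundary i j : C i j -> Prop :=
  if j is j'.+1 then fun x => exists y, x = d2 i j' y
  else fun x => exists y, x = eta i y.

Definition edge_boundary (D : nat -> zmodType)
    (d : forall i, {additive D i -> D i.+1}) i : D i -> Prop :=
  if i is i'.+1 then fun x => exists y, x = d i' y else fun x => x = 0.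

Definition column_boundary i j : C i j -> Prop :=
  if i is i'.+1 then fun x => exists y, x = d1 i' j y
  else fun x => exists y, x = theta j y.

Lemma row_boundaryP i j x : d2 i j x = 0 -> row_boundary x.
Proof.
by case: j x => [|j] x /=; [move/row_exact0|move/row_exact] => -[y yx]; exists y.
Qed.

Lemma column_boundary_cycle i j (x : C i j) : column_boundary x -> d1 i j x = 0.
Proof. by case: i x => [|i] x /= [y ->]; [exact: d1_theta|exact: d1d1]. Qed.

(** Each step lifts [d2 u] along [d1], so the zigzag started at total degree i + j runs on the next
    antidiagonal; it ends in a cocycle of F of degree i + j + 1, whence the shift in the
    hypothesis. *)
Lemma diagonal_cosplit i j (u : C i j) :
  (forall z, dF (i + j).+1 z = 0 -> exists w, dF (i + j)%N w = z) ->
  d1 i j.+1 (d2 i j u) = 0 ->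
  exists v w, [/\ column_boundary v, row_boundary w & u = v + w].
Proof.
elim: i j u => [|i IH] j u HF /= cu.
  have [x xE] := col_exact0 cu.
  have [|w wx] := HF x.
    by apply: theta_inj; rewrite -d2_theta xE d2d2.
  have /row_boundaryP rb : d2 0%N j (u - theta j w) = 0.
    by rewrite raddfB /= d2_theta wx xE subrr.
  exists (theta j w), (u - theta j w); split => //; first by exists w.
  by rewrite addrC subrK.
have [x xE] := col_exact cu.
have {}HF : forall z, dF (i + j.+1).+1 z = 0 -> exists w, dF (i + j.+1)%N w = z.
  by rewrite addnS; exact: HF.
have [|v [w [/column_boundary_cycle cv /= [t tE] vw]]] := IH _ x HF.
  by rewrite d1d2 xE d2d2.
have /row_boundaryP rb : d2 i.+1 j (u - d1 i j t) = 0.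
  by rewrite raddfB /= -d1d2 -tE -xE vw raddfD /= cv add0r subrr.
exists (d1 i j t), (u - d1 i j t); split => //; first by exists t.
by rewrite addrC subrK.
Qed.

Lemma double_complex_cohomology n :
  (forall z, dF n z = 0 -> edge_boundary dF z) ->
  (forall z, dE n z = 0 -> edge_boundary dE z).
Proof.
case: n => [|n] HF z cz.
  (* In degree 0 there is no earlier antidiagonal: [eta z] is killed by both differentials, so it
     comes from a cocycle of F in degree 0, which vanishes. *)
  apply: eta_inj; have := d1_eta z; rewrite cz raddf0 => /col_exact0[y yz].
  suff y0 : y = 0 by rewrite -yz y0 raddf0.
  by apply: HF; apply: theta_inj; rewrite -d2_theta yz d2_eta.
have := d1_eta z; rewrite cz raddf0 => /col_exact[u uE].
have HF' : forall z', dF n.+1 z' = 0 -> exists w, dF n w = z'.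
  by move=> z' /HF /= [w ->]; exists w.
have [||v [w [/column_boundary_cycle cv [y yE] vw]]] :=
  @diagonal_cosplit n 0%N u.
- by rewrite addn0.
- by rewrite d1d2 uE d2_eta.
exists y; apply/eqP; rewrite -subr_eq0; apply/eqP/eta_inj.
by rewrite raddfB /= -uE vw raddfD /= cv add0r yE d1_eta subrr.
Qed.

End DoubleComplexCohomology.

(** * Faces of the nerve and finitely supported functions *)

Section Faces.
Variable G : groupType.

(* The face maps on infinite sequences, where the bounds play no role. *)
Let sface (i : nat) (w : nat -> G) (k : nat) : G :=
  if (k.+1 < i)%N then w k
  else if k.+1 == i then (w k * w k.+1)%g else w k.+1.

Lemma tnth_face n (i : 'I_n.+2) (u : n.+1.-tuple G) (k : 'I_n) :
  tnth (face i u) k = sface i (nth 1%g u) k.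
Proof. by rewrite tnth_mktuple !(tnth_nth 1%g) /=. Qed.

Lemma nth_face n (i : 'I_n.+2) (u : n.+1.-tuple G) k : (k < n)%N ->
  nth 1%g (face i u) k = sface i (nth 1%g u) k.
Proof. by move=> kn; rewrite -[k]/(val (Ordinal kn)) -tnth_nth tnth_face. Qed.

Lemma sface_sface (i j : nat) w k : (i <= j)%N ->
  sface i (sface j.+1 w) k = sface j (sface i w) k.
Proof.
rewrite /sface => ij; have [h1|h1|h1] := ltngtP k.+1 i;
  have [h2|h2|h2] := ltngtP k.+1 j;
  repeat (case: ifP => ?); rewrite ?mulgA //; try lia.
Qed.

Lemma face_face n (i j : 'I_n.+2) (u : n.+2.-tuple G) : (i <= j)%N ->
  face i (face (lift ord0 j) u) = face j (face (widen_ord (leqnSn _) i) u).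
Proof.
move=> ij; apply: eq_from_tnth => k; rewrite !tnth_face.
rewrite /sface !nth_face ?ltnS ?(ltnW (ltn_ord k))//.
exact: sface_sface.
Qed.

(* The group element through which the i-th face acts on coefficients. *)
Definition face_elt n (i : 'I_n.+2) (u : n.+1.-tuple G) : G :=
  if i == ord0 then thead u else 1%g.

(** The cocycle relation over the simplicial identity [face_face]; it makes the (co)boundary square
    to zero with twisted coefficients. *)
Lemma face_elt_face n (i j : 'I_n.+2) (u : n.+2.-tuple G) : (i <= j)%N ->
  face_elt i (face (lift ord0 j) u) =
  (face_elt (widen_ord (leqnSn _) i) u *
     face_elt j (face (widen_ord (leqnSn _) i) u))%g.
Proof.
rewrite /face_elt /thead !tnth_face !(tnth_nth 1%g) /sface /= -!val_eqE /=.
case: (i : nat) (j : nat) => [|i'] [|j'] //=; rewrite ?mulg1 //.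
Qed.

Lemma face0_cons n k (u : n.-tuple G) : face ord0 [tuple of k :: u] = u.
Proof. by apply: eq_from_tnth => j; rewrite tnth_face /sface /= -tnth_nth. Qed.

Lemma face1_cons n k (u : n.+1.-tuple G) :
  face (lift ord0 ord0) [tuple of k :: u] =
  [tuple of (k * thead u)%g :: face ord0 u].
Proof.
apply: eq_from_tnth => j; rewrite tnth_face (tnth_nth 1%g) /sface /=.
case: j => -[|j] jn //=; first by rewrite /thead (tnth_nth 1%g).
exact: (esym (@nth_face _ ord0 u j jn)).
Qed.

Lemma faceSS_cons n k (i : 'I_n.+1) (u : n.+1.-tuple G) :
  face (lift ord0 (lift ord0 i)) [tuple of k :: u] =
  [tuple of k :: face (lift ord0 i) u].
Proof.
apply: eq_from_tnth => j; rewrite tnth_face (tnth_nth 1%g) /sface /=.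
case: j => -[|j] jn //=; exact: (esym (@nth_face _ (lift ord0 i) u j jn)).
Qed.

Lemma thead_cons n k (u : n.-tuple G) : thead [tuple of k :: u] = k.
Proof. by []. Qed.

End Faces.

(** The term at (j + 1, i) with i <= j cancels against the one at (i, j), whose sign is opposite. *)
Lemma alternating_double_sum (R : pzRingType) (V : lmodType R) m
    (F : 'I_m.+1 -> 'I_m -> V) :
    (forall i j : 'I_m, (i <= j)%N ->
       F (lift ord0 j) i = F (widen_ord (leqnSn _) i) j) ->
  \sum_(j < m.+1) \sum_(i < m) ((-1) ^+ (j + i) *: F j i) = 0.
Proof.
move=> FE; rewrite (eq_bigr (fun j : 'I_m.+1 =>
    \sum_(i : 'I_m | (i < j)%N) ((-1) ^+ (j + i) *: F j i) +
    \sum_(i : 'I_m | (j <= i)%N) ((-1) ^+ (j + i) *: F j i))); last first.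
  move=> j _; rewrite (bigID (fun k : 'I_m => (k < j)%N)) /=; congr (_ + _).
  by apply: eq_bigl => k; rewrite -leqNgt.
(* The first row has no i < j and the last row no i >= j; once these are removed, both halves are
   indexed by pairs in ['I_m]. *)
rewrite big_split /= big_ord_recl /= big_pred0 // add0r.
rewrite [X in _ + X]big_ord_recr /= [X in _ + (_ + X)]big_pred0; last first.
  by move=> i; rewrite leqNgt ltn_ord.
rewrite addr0 [X in _ + X](exchange_big_dep xpredT) //= -big_split /=.
apply: big1 => j _; apply/eqP; rewrite addr_eq0 -sumrN; apply/eqP.
apply: eq_big => [i|i]; first by rewrite ltnS.
by rewrite ltnS => ij; rewrite FE// addSn exprS mulN1r scaleNr addnC.
Qed.

Section FinitelySupportedFunctions.
Context {R : pzRingType}.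

Definition fsingle_fun (T : choiceType) (V : lmodType R) (t : T) (v : V) : T -> V :=
  fun t' => if t' == t then v else 0.

Lemma fsingle_fin (T : choiceType) (V : lmodType R) (t : T) (v : V) :
  fsingle_fun t v \in @fin_pred R T V.
Proof.
apply/asboolP; apply: (@sub_finite_set _ _ [set t]); last exact: finite_set1.
by move=> t' /=; rewrite /fsingle_fun; case: eqP.
Qed.

Definition fsingle (T : choiceType) (V : lmodType R) (t : T) (v : V) : finfunc T V :=
  FinFunc (fsingle_fin t v).

Lemma finfuncE (T : choiceType) (V : lmodType R) (f g : finfunc T V) :
  f =1 g -> f = g.
Proof. by move=> fg; apply: val_inj; apply/funext. Qed.

Definition feval (T : choiceType) (V : lmodType R) (t : T) (f : finfunc T V) : V :=
  f t.
#[global] Arguments feval : simpl never.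

Lemma feval_linear (T : choiceType) (V : lmodType R) (t : T) :
  linear (@feval T V t).
Proof. by []. Qed.
HB.instance Definition _ (T : choiceType) (V : lmodType R) (t : T) :=
  GRing.isLinear.Build R (finfunc T V) V *:%R (@feval T V t) (@feval_linear T V t).

Lemma fsingle_linear (T : choiceType) (V : lmodType R) (t : T) :
  linear (@fsingle T V t).
Proof.
move=> r v w; apply: finfuncE => t'; transitivity
  (r *: fsingle_fun t v t' + fsingle_fun t w t') => //.
by rewrite /= /fsingle_fun; case: eqP => // _; rewrite scaler0 addr0.
Qed.
HB.instance Definition _ (T : choiceType) (V : lmodType R) (t : T) :=
  GRing.isLinear.Build R V (finfunc T V) *:%R (@fsingle T V t) (@fsingle_linear T V t).

Lemma finfunc_sum (T : choiceType) (V : lmodType R) (f : finfunc T V) :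
  f = \sum_(t <- fset_set [set t | f t <> 0]) fsingle t (f t).
Proof.
apply: finfuncE => t; rewrite -[RHS]/(feval t _) raddf_sum /=.
rewrite /feval /= /fsingle_fun.
have [ft0|ft0] := pselect (f t = 0).
  by rewrite ft0 big1_seq // => t' _; case: eqP => // <-.
rewrite (bigD1_seq t) ?fset_uniq //=; last first.
  by rewrite in_fset_set ?inE//; exact: finfuncP.
by rewrite eqxx big1 ?addr0 // => t' /negbTE; rewrite eq_sym => ->.
Qed.

Lemma finfunc_ind (T : choiceType) (V : lmodType R) (P : finfunc T V -> Prop) :
    P 0 -> (forall f g, P f -> P g -> P (f + g)) ->
    (forall t v, P (fsingle t v)) -> forall f, P f.
Proof. by move=> P0 PD P1 f; rewrite (finfunc_sum f); elim/big_ind : _. Qed.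

Section Map.
Variables (T : choiceType) (V W : lmodType R) (f : {linear V -> W}).

Lemma map_fin_subproof (x : finfunc T V) : (fun t => f (x t)) \in @fin_pred R T W.
Proof.
apply/asboolP; apply: sub_finite_set (finfuncP x) => t /= fx x0.
by apply: fx; rewrite x0 raddf0.
Qed.

Definition map_fin (x : finfunc T V) : finfunc T W := FinFunc (map_fin_subproof x).

Lemma map_fin_linear : linear map_fin.
Proof.
move=> r x y; apply: finfuncE => t.
by transitivity (f (r *: x t + y t)) => //; rewrite linearP.
Qed.
HB.instance Definition _ :=
  GRing.isLinear.Build R (finfunc T V) (finfunc T W) *:%R map_fin map_fin_linear.

Lemma map_fin_single t v : map_fin (fsingle t v) = fsingle t (f v).
Proof.
apply: finfuncE => t'; rewrite /= /fsingle_fun.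
by case: eqP => // _; rewrite raddf0.
Qed.

Lemma map_fin_surj : (forall w, exists v, f v = w) -> forall y, exists x, map_fin x = y.
Proof.
move=> fs y; have [g gP] : {g : W -> V & forall w, f (g w) = w}.
  exact: (@choice _ _ (fun w v => f v = w) fs).
(* The chosen preimage of 0 may be nonzero, so 0 is forced wherever [y] vanishes, to keep the
   support finite. *)
have gfin : (fun t => if y t == 0 then 0 else g (y t)) \in @fin_pred R T V.
  apply/asboolP; apply: sub_finite_set (finfuncP y) => t /= gy y0.
  by apply: gy; rewrite y0 eqxx.
exists (FinFunc gfin); apply: finfuncE => t /=.
by case: eqP => [->|_]; [rewrite raddf0|rewrite gP].
Qed.

End Map.

Lemma map_fin_exact (T : choiceType) (U V W : lmodType R) (f : {linear U -> V})
    (g : {linear V -> W}) :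
  (forall v, g v = 0 -> exists u, f u = v) ->
  forall y : finfunc T V, map_fin g y = 0 -> exists x, map_fin f x = y.
Proof.
move=> fg y gy.
have /choice[h hP] : forall v, exists u, g v = 0 -> f u = v.
  by move=> v; have [/fg[u fu]|gv] := pselect (g v = 0); [exists u|exists 0].
have hfin : (fun t => if y t == 0 then 0 else h (y t)) \in @fin_pred R T U.
  apply/asboolP; apply: sub_finite_set (finfuncP y) => t /= hy y0.
  by apply: hy; rewrite y0 eqxx.
exists (FinFunc hfin); apply: finfuncE => t /=.
case: eqP => [->|_]; first by rewrite raddf0.
by apply: hP; have := congr1 (feval t) gy.
Qed.

End FinitelySupportedFunctions.

(** * The bar complexes *)

HB.instance Definition _ (R : comPzRingType) (G : groupType) (V : gmodule R G) g :=
  GRing.isLinear.Build R V V *:%R (@gmod_act R G V g) (gmod_act_linear g).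

Definition equivariant (R : comPzRingType) (G : groupType) (V W : gmodule R G)
    (f : V -> W) : Prop :=
  forall g v, f (gmod_act g v) = gmod_act g (f v).

Section Chains.
Variables (R : comPzRingType) (G : groupType).
Implicit Types V W : gmodule R G.

Lemma chain_ind V n (P : chain V n -> Prop) :
    P 0 -> (forall f g, P f -> P g -> P (f + g)) ->
    (forall u v, P (fsingle u v)) -> forall f, P f.
Proof. exact: finfunc_ind. Qed.

Lemma boundary_single V n (u : n.+1.-tuple G) (v : V) :
  boundary (fsingle u v : chain V n.+1) =
  \sum_(i < n.+2) (-1) ^+ i *:
    (fsingle (face i u) (gmod_act (face_elt i u)^-1%g v) : chain V n).
Proof.
apply: finfuncE => t; rewrite -[RHS]/(feval t _) linear_sum.
apply: eq_bigr => i _; rewrite linearZ /=; congr (_ *: _).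
rewrite (@fsum_supp _ _ _ _ [set u]); last 2 first.
- exact: finite_set1.
- move=> u' /=; rewrite /fsingle_fun; case: (u' =P u) => // _.
  by rewrite gmod_act0 if_same.
rewrite fset_set1 big_seq_fset1 /= /feval /= /fsingle_fun eqxx /face_elt.
have -> : (u \in face i @^-1` [set t]) = (t == face i u).
  by apply/idP/eqP; rewrite inE /= => ->.
by case: eqP => // _; case: eqP => // _; rewrite invg1 gmod_act1.
Qed.

Lemma boundary_boundary V n (f : chain V n.+2) : boundary (boundary f) = 0.
Proof.
elim/chain_ind: f => [|f g f0 g0|u v].
- by rewrite !raddf0.
- by rewrite raddfD /= raddfD /= f0 g0 addr0.
rewrite boundary_single linear_sum.
under eq_bigr => j _ do rewrite linearZ /= boundary_single scaler_sumr.
under eq_bigr => j _ do under eq_bigr => i _ do rewrite scalerA -exprD -gmod_actM.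
apply: (alternating_double_sum (F := fun j i =>
  fsingle (face i (face j u)) (gmod_act _ v) : chain V n)) => i j ij.
by rewrite face_face// -!invgM -face_elt_face// mul1g.
Qed.

Lemma boundary_map_fin V W n (f : {linear V -> W}) (x : chain V n.+1) :
  equivariant f -> boundary (map_fin f x : chain W n.+1) = map_fin f (boundary x).
Proof.
move=> fE; elim/chain_ind: x => [|x y xE yE|u v].
- by rewrite !raddf0.
- by rewrite raddfD /= raddfD /= xE yE -raddfD -raddfD.
rewrite map_fin_single !boundary_single linear_sum; apply: eq_bigr => i _.
by rewrite linearZ /= map_fin_single fE.
Qed.

Lemma coboundary_face V n (f : cochain V n) (u : n.+1.-tuple G) :
  coboundary f u =
  \sum_(i < n.+2) (-1) ^+ i *: gmod_act (face_elt i u) (f (face i u)).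
Proof.
apply: eq_bigr => i _; congr (_ *: _); rewrite /face_elt.
by case: eqP => // _; rewrite gmod_act1.
Qed.

Lemma coboundary_coboundary V n (f : cochain V n) : coboundary (coboundary f) = 0.
Proof.
apply/funext => u; rewrite coboundary_face.
under eq_bigr => j _ do rewrite coboundary_face linear_sum scaler_sumr.
under eq_bigr => j _ do under eq_bigr => i _ do
  rewrite linearZ /= scalerA -exprD -gmod_actM.
apply: (alternating_double_sum (F := fun j i =>
  gmod_act (_ : G) (f (face i (face j u))))) => i j ij.
by rewrite face_face// -face_elt_face// mul1g.
Qed.

Lemma coboundary_comp V W n (f : {linear V -> W}) (x : cochain V n) :
  equivariant f -> coboundary (f \o x : cochain W n) = f \o coboundary x.
Proof.
move=> fE; apply/funext => u /=; rewrite !coboundary_face linear_sum.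
by apply: eq_bigr => i _; rewrite linearZ /= fE.
Qed.

End Chains.

(** * Relatively projective modules *)

(** Finitely supported sums over a group are written over any duplicate-free list containing the
    support, so that several vectors can share a list; this makes the choice immaterial. *)
Lemma eq_big_support (V : nmodType) (I : choiceType) (S S' : seq I) (F : I -> V) :
    uniq S -> uniq S' -> (forall i, F i <> 0 -> i \in S) ->
    (forall i, F i <> 0 -> i \in S') ->
  \sum_(i <- S) F i = \sum_(i <- S') F i.
Proof.
move=> uS uS' FS FS'.
rewrite (bigID (fun i => F i == 0)) /= big1 ?add0r; last by move=> i /eqP.
rewrite [RHS](bigID (fun i => F i == 0)) /= [X in _ = X + _]big1 ?add0r;
  last by move=> i /eqP.
rewrite -big_filter -[RHS]big_filter; apply: perm_big.
apply: uniq_perm; rewrite ?filter_uniq// => i; rewrite !mem_filter.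
by case: eqP => //= /[dup] /FS -> /FS' ->.
Qed.

Section RelativelyProjective.
Variables (R : comPzRingType) (G : groupType) (V : gmodule R G).
Variable e : {linear V -> V}.

(* The sum over k of the conjugates of e is (finite at every vector and) the
   identity, so that V is a direct summand of an induced module. *)
Definition trace_decomposition : Prop := forall v, exists S : seq G,
  [/\ uniq S, forall k, e (gmod_act k v) <> 0 -> k \in S &
      \sum_(k <- S) gmod_act k^-1%g (e (gmod_act k v)) = v].

Hypothesis eV : trace_decomposition.

Lemma cone_fin n (f : chain V n) :
  (fun u : n.+1.-tuple G => e (gmod_act (thead u) (f [tuple of behead u])))
    \in @fin_pred R _ V.
Proof.
apply/asboolP; apply: (@sub_finite_set _ _ (\bigcup_(t in [set t | f t <> 0])
   ((fun k => [tuple of k :: t]) @` [set k | e (gmod_act k (f t)) <> 0]))).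
  move=> u /= eu; exists [tuple of behead u].
    by move=> /= f0; apply: eu; rewrite f0 gmod_act0 raddf0.
  by exists (thead u) => //; rewrite -tuple_eta.
apply: bigcup_finite => [|t _]; first exact: finfuncP.
apply: finite_image; have [S [_ HS _]] := eV (f t).
by apply: (@sub_finite_set _ _ [set` S]) => // k /= /HS.
Qed.

Definition cone n (f : chain V n) : chain V n.+1 := FinFunc (cone_fin f).

Lemma cone_linear n : linear (@cone n).
Proof.
move=> r x y; apply: finfuncE => u.
transitivity (e (gmod_act (thead u)
  (r *: x [tuple of behead u] + y [tuple of behead u]))) => //.
by rewrite !linearP.
Qed.
HB.instance Definition _ n :=
  GRing.isLinear.Build R (chain V n) (chain V n.+1) *:%R (@cone n) (@cone_linear n).

Lemma cone_single n (u : n.-tuple G) (v : V) (S : seq G) :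
    uniq S -> (forall k, e (gmod_act k v) <> 0 -> k \in S) ->
  cone (fsingle u v) =
  \sum_(k <- S) (fsingle [tuple of k :: u] (e (gmod_act k v)) : chain V n.+1).
Proof.
move=> uS HS; apply: finfuncE => t; rewrite -[RHS]/(feval t _) linear_sum.
rewrite [LHS]/= /fsingle_fun; case: eqP => [tu|tu]; last first.
  rewrite gmod_act0 raddf0 big1 // => k _; rewrite /= /feval /= /fsingle_fun.
  case: eqP => // tku; case: tu; rewrite tku.
  by apply: val_inj.
have tE k : (t == [tuple of k :: u]) = (k == thead t).
  apply/eqP/eqP => [->//|->]; rewrite -tu {1}(tuple_eta t).
  exact: val_inj.
rewrite [RHS](_ : _ = \sum_(k <- S | k == thead t) e (gmod_act k v)); last first.
  rewrite [RHS]big_mkcond; apply: eq_bigr => k _.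
  by rewrite /= /feval /= /fsingle_fun tE.
have [tS|tS] := boolP (thead t \in S).
  rewrite -big_filter (_ : [seq _ <- S | _] = [:: thead t]) ?big_seq1//.
  by rewrite -[RHS](@filter_pred1_uniq _ S).
rewrite big_seq_cond big1 => [|k /andP[kS /eqP kt]]; last first.
  by rewrite -kt kS in tS.
by apply: contrapT => /HS; rewrite (negbTE tS).
Qed.

(** On v at (g_1, ...), the cone is the sum over k of e(k.v) at (k, g_1, ...). Its face 0 returns v
    by the trace decomposition; its face 1 cancels the cone of face 0 after replacing k by k g_1;
    the higher faces cancel in pairs, as prefixing k shifts the index and hence the sign. *)
Lemma boundary_cone n (f : chain V n.+1) : boundary (cone f) + cone (boundary f) = f.
Proof.
elim/chain_ind: f => [|f g fE gE|u v].
- by rewrite !raddf0 addr0.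
- rewrite [cone _]raddfD [boundary (f + g)]raddfD /= !raddfD /=.
  by rewrite addrACA fE gE.
have [S [uS HS Sv]] := eV v.
rewrite (cone_single u uS HS) linear_sum /= boundary_single linear_sum /=.
have uS' : uniq [seq (k * thead u)%g | k <- S].
  by rewrite map_inj_uniq//; exact: mulIg.
have HS' k : e (gmod_act k (gmod_act (thead u)^-1%g v)) <> 0 ->
    k \in [seq (k * thead u)%g | k <- S].
  rewrite -gmod_actM => /HS kS; apply/mapP.
  by exists (k * (thead u)^-1)%g => //; rewrite mulgVK.
under eq_bigr => k _ do rewrite boundary_single 2!big_ord_recl face0_cons
  face1_cons /face_elt /= thead_cons invg1 gmod_act1 expr0 scale1r expr1 scaleN1r.
rewrite big_split big_split /= -linear_sum Sv -addrA -[RHS]addr0; congr (_ + _).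
rewrite [X in _ + X]big_ord_recl /face_elt /= linearZ /= expr0 scale1r.
rewrite (cone_single _ uS' HS') big_map.
under [X in _ + _ + (X + _)]eq_bigr => k _ do rewrite -gmod_actM mulgK.
rewrite addrACA -big_split /= big1 ?add0r; last by move=> k _; rewrite addNr.
rewrite exchange_big -big_split /= big1 // => i _.
rewrite invg1 gmod_act1 linearZ /= (cone_single _ uS HS) scaler_sumr -big_split.
rewrite big1 // => k _ /=; rewrite faceSS_cons.
by rewrite /bump /= !add1n exprS mulN1r scaleNr addNr.
Qed.

Lemma boundary_exact n (f : chain V n.+1) :
  boundary f = 0 -> exists x, boundary x = f.
Proof.
by move=> f0; exists (cone f); rewrite -[RHS]boundary_cone f0 raddf0 addr0.
Qed.

(** In degree 0 the face 1 of (k) survives: the boundary of the cone of v is v minus the sum of the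
    e(k.v). *)
Lemma boundary_exact0 (v : V) :
    (forall S : seq G, uniq S -> (forall k, e (gmod_act k v) <> 0 -> k \in S) ->
       \sum_(k <- S) e (gmod_act k v) = 0) ->
  exists x : chain V 1, boundary x = fsingle [tuple] v.
Proof.
have [S [uS HS Sv]] := eV v => /(_ S uS HS) S0.
exists (cone (fsingle [tuple] v)); rewrite (cone_single _ uS HS) linear_sum /=.
under eq_bigr => k _ do rewrite boundary_single 2!big_ord_recl big_ord0 face0_cons
  /face_elt /= thead_cons invg1 gmod_act1 expr0 scale1r expr1 scaleN1r
  [face (lift _ _) _]tuple0 addr0.
rewrite big_split /= sumrN -linear_sum Sv.
by rewrite -(linear_sum (@fsingle _ _ V [tuple])) S0 raddf0 subr0.
Qed.

End RelativelyProjective.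

(** * Nonvanishing of (co)homology *)

Section SubquotientTheory.
Variables (R : pzRingType) (A B C : lmodType R).
Variables (f : {linear A -> B}) (g : {linear B -> C}).

Lemma pi_subquotient_eq0 (z : kernel g) :
  \pi_(subquotient f g) z = 0 <-> exists a, f a = kernel_val z.
Proof.
have -> : (0 : subquotient f g) = \pi_(subquotient f g) 0.
  by rewrite raddf0.
split=> [/eqP|fz].
  by rewrite -Quotient.idealrBE subr0 => /asboolP.
by apply/eqP; rewrite -Quotient.idealrBE subr0; apply/asboolP.
Qed.

Lemma pi_subquotient_linear : linear (fun z : kernel g => \pi_(subquotient f g) z).
Proof.
move=> r x y; rewrite raddfD; congr (_ + _).
exact/esym/subquotient_scaleE.
Qed.

Lemma nonzero_subquotientP :
  nonzero_module (subquotient f g) <->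
  ~ (forall b, g b = 0 -> exists a, f a = b).
Proof.
split=> [[x x0] H|H].
  apply: x0; rewrite -[x]reprK; apply/pi_subquotient_eq0/H.
  by have := valP (repr x); rewrite inE => /eqP.
apply: contrapT => x0; apply: H => b gb.
have bk : b \in ker_pred g by rewrite inE gb.
apply/(pi_subquotient_eq0 (Kernel bk)); apply: contrapT => pb.
by apply: x0; exists (\pi_(subquotient f g) (Kernel bk)).
Qed.

End SubquotientTheory.

Section Nonvanishing.
Variables (R : comPzRingType) (G : groupType) (V : gmodule R G).

Lemma nonzero_homologyP n :
  nonzero_module (group_homology V n) <->
  ~ (forall z, edge_cycle (fun i => @boundary R G V i) z ->
       exists w : chain V n.+1, boundary w = z).
Proof.
case: n => [|n] /=; rewrite nonzero_subquotientP //.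
by split=> H H'; apply: H => z _; [exact: H'|exact: H'].
Qed.

Lemma nonzero_cohomologyP n :
  nonzero_module (group_cohomology V n) <->
  ~ (forall z : cochain V n, coboundary z = 0 ->
       edge_boundary (D := fun i => cochain V i) (fun i => @coboundary R G V i) z).
Proof.
case: n => [|n] /=; rewrite nonzero_subquotientP //.
  split=> H H'; apply: H => z /H'.
    by move=> ->; exists 0.
  by case=> a <-.
by split=> H H'; apply: H => z /H'[a E]; exists a.
Qed.

End Nonvanishing.

(** * Homology of modules over two commuting groups *)

Lemma fsingle_nil (R : pzRingType) (T : choiceType) (V : lmodType R)
    (f : finfunc (0.-tuple T) V) :
  fsingle [tuple] (f [tuple]) = f.
Proof.
apply: finfuncE => t; have -> : t = [tuple] by exact: tuple0.
by rewrite /= /fsingle_fun (introT eqP erefl).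
Qed.

Section FinGModule.
Variables (R : comPzRingType) (G : groupType) (T : choiceType) (V : gmodule R G).

Lemma fin_act_linear (g : G) : linear (map_fin (T := T) (@gmod_act R G V g)).
Proof. exact: linearP. Qed.

Lemma fin_act1 (f : finfunc T V) : map_fin (@gmod_act R G V 1%g) f = f.
Proof. by apply: finfuncE => t /=; rewrite gmod_act1. Qed.

Lemma fin_actM (g h : G) (f : finfunc T V) :
  map_fin (@gmod_act R G V (g * h)%g) f =
  map_fin (@gmod_act R G V g) (map_fin (@gmod_act R G V h) f).
Proof. by apply: finfuncE => t /=; rewrite gmod_actM. Qed.

(** With [T] the j-tuples of H, this turns the bar j-chains of H into G-modules: column j of the
    double complex is then an ordinary bar complex of G. *)
Definition fin_gmodule : gmodule R G := GModule fin_act_linear fin_act1 fin_actM.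

Lemma fin_trace_decomposition (e : {linear V -> V}) :
  trace_decomposition e -> @trace_decomposition R G fin_gmodule (map_fin (T := T) e).
Proof.
move=> /choice[S SP] f.
pose K := undup (flatten [seq S (f t) | t <- fset_set [set t | f t <> 0]]).
have HK t k : e (gmod_act k (f t)) <> 0 -> k \in K.
  move=> ek; rewrite mem_undup; apply/flatten_mapP; exists t.
    rewrite in_fset_set ?inE; last exact: finfuncP.
    by move=> /= f0; apply: ek; rewrite f0 !raddf0.
  by have [_ + _] := SP (f t); apply.
exists K; split; first exact: undup_uniq.
  move=> k ek; apply: contrapT => kK; apply: ek; apply: finfuncE => t.
  by apply: contrapT => /HK.
apply: finfuncE => t; rewrite -[LHS]/(feval t _) linear_sum.
have [uS HS Sv] := SP (f t); rewrite -[RHS]Sv.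
apply: eq_big_support => //; first exact: undup_uniq.
- move=> k kt; apply: (HK t) => e0; apply: kt.
  by rewrite /= /feval /= e0 raddf0.
- by move=> k kt; apply: HS => e0; apply: kt; rewrite /= /feval /= e0 raddf0.
Qed.

End FinGModule.

Section CoinvariantQuotient.
Variables (R : comPzRingType) (G : groupType).

(** [p] exhibits [M] as V_G. The kernel is given by bar boundaries rather than by generators g.v -
    v, which is directly exactness of the augmented bar complex in degree 0. *)
Definition coinvariant_quotient (V : gmodule R G) (M : lmodType R)
    (p : {linear V -> M}) : Prop :=
  [/\ forall g v, p (gmod_act g v) = p v, forall m, exists v, p v = m &
      forall v, p v = 0 -> exists x : chain V 1, boundary x = fsingle [tuple] v].

Lemma coinvariant_boundary (V : gmodule R G) (M : lmodType R) (p : {linear V -> M})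
    (x : chain V 1) :
  (forall g v, p (gmod_act g v) = p v) -> p (boundary x [tuple]) = 0.
Proof.
move=> pE; rewrite -[boundary x _]/(feval _ _); elim/chain_ind: x => [|x y xE yE|u v].
- by rewrite !raddf0.
- by rewrite raddfD /= raddfD [X in X + _]xE [X in _ + X]yE addr0.
rewrite boundary_single 2!big_ord_recl big_ord0 addr0 expr0 scale1r expr1 scaleN1r.
have E i : ([tuple] == face i u) by rewrite [face _ _]tuple0.
rewrite raddfB /= /fsingle_fun !E.
by rewrite /face_elt /= invg1 gmod_act1 pE subrr.
Qed.

Lemma fin_coinvariant_quotient (T : choiceType) (V : gmodule R G) (M : lmodType R)
    (p : {linear V -> M}) :
  coinvariant_quotient p ->
  @coinvariant_quotient (fin_gmodule T V) (finfunc T M) (map_fin p).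
Proof.
move=> [pE ps pk]; split.
- by move=> g f; apply: finfuncE => t /=; rewrite pE.
- exact: map_fin_surj.
move=> f pf.
have /choice[x xP] : forall t, exists x : chain V 1, boundary x = fsingle [tuple] (f t).
  by move=> t; apply: pk; have := congr1 (feval t) pf.
have sE t : @equivariant R G V (fin_gmodule T V) (fsingle t).
  by move=> g v; rewrite /= map_fin_single.
exists (\sum_(t <- fset_set [set t | f t <> 0])
   (map_fin (fsingle t : {linear V -> fin_gmodule T V}) (x t)
      : chain (fin_gmodule T V) 1)).
rewrite linear_sum /= [in RHS](finfunc_sum f) linear_sum.
apply: eq_bigr => t _.
rewrite (@boundary_map_fin R G V (fin_gmodule T V)); last exact: sE.
by rewrite xP map_fin_single.
Qed.

End CoinvariantQuotient.

Section HomologyTransfer.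
Variables (R : comPzRingType) (G H : groupType) (N : lmodType R).
Variables (aG : G -> N -> N) (aH : H -> N -> N).
Hypothesis aG_linear : forall g, linear (aG g).
Hypothesis aG1 : forall v, aG 1%g v = v.
Hypothesis aGM : forall g h v, aG (g * h)%g v = aG g (aG h v).
Hypothesis aH_linear : forall h, linear (aH h).
Hypothesis aH1 : forall v, aH 1%g v = v.
Hypothesis aHM : forall g h v, aH (g * h)%g v = aH g (aH h v).
Hypothesis aGH : forall g h v, aG g (aH h v) = aH h (aG g v).

HB.instance Definition _ g := GRing.isLinear.Build R N N *:%R (aG g) (aG_linear g).
HB.instance Definition _ h := GRing.isLinear.Build R N N *:%R (aH h) (aH_linear h).

Let NG : gmodule R G := GModule aG_linear aG1 aGM.
Let NH : gmodule R H := GModule aH_linear aH1 aHM.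

Section WithCoinvariants.
Variables (eG eH : {linear N -> N}).
Hypothesis eGP : @trace_decomposition R G NG eG.
Hypothesis eHP : @trace_decomposition R H NH eH.
Variables (M : gmodule R G) (p : {linear N -> M}).
Hypothesis pG : @equivariant R G NG M p.
Hypothesis pH : @coinvariant_quotient R H NH M p.
Variables (W : gmodule R H) (q : {linear N -> W}).
Hypothesis qH : @equivariant R H NH W q.
Hypothesis qG : @coinvariant_quotient R G NG W q.

Let V j : gmodule R G := fin_gmodule (j.-tuple H) NG.
Let C i j := chain (V j) i.

Let d2_ i j : {linear C i j.+1 -> C i j} :=
  map_fin (T := i.-tuple G) (@boundary R H NH j).
Let p_ i : {linear C i 0 -> chain M i} :=
  map_fin (T := i.-tuple G) (p \o @feval R (0.-tuple H) N [tuple]).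
Let q_ j : {linear C 0%N j -> chain W j} :=
  map_fin (T := j.-tuple H) q \o @feval R (0.-tuple G) (V j) [tuple].

(** Rows are bar complexes of H, exact by [eHP] and augmented to chains of G in M = N_H; columns are
    bar complexes of G, exact by [eGP] and augmented to chains of H in W = N_G. *)
Lemma homology_transfer n :
  (forall z, edge_cycle (fun i => @boundary R H W i) z ->
    exists w : chain W n.+1, boundary w = z) ->
  (forall z, edge_cycle (fun i => @boundary R G M i) z ->
    exists w : chain M n.+1, boundary w = z).
Proof.
have [pE ps pk] := pH; have [qE qs qk] := qG.
apply: (@double_complex_homology (fun i j => C i j) (fun i => chain M i)
  (fun j => chain W j) (fun i j => @boundary R G (V j) i) (fun i j => d2_ i j)
  (fun i => @boundary R G M i) (fun j => @boundary R H W j)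
  (fun i => p_ i) (fun j => q_ j)).
- move=> i j x; apply: (@boundary_map_fin R G (V j.+1) (V j)) => g v.
  pose f : {linear NH -> NH} := (aG g : {linear N -> N}).
  have fE : @equivariant R H NH NH f by move=> h w; exact: aGH.
  exact: (@boundary_map_fin R H NH NH j f v fE).
- by move=> i j x; exact: boundary_boundary.
- by move=> i j x; apply: finfuncE => u; exact: (@boundary_boundary R H NH).
- move=> i x; apply/esym/(@boundary_map_fin R G (V 0%N) M) => g v.
  exact: pG.
- move=> j x; apply/esym/(@boundary_map_fin R H NH W) => h v.
  exact: qH.
- move=> i x; apply: finfuncE => u; exact: (@coinvariant_boundary R H NH M p).
- move=> j x.
  apply: (@coinvariant_boundary R G (V j) (finfunc (j.-tuple H) W) (map_fin q)).
  by move=> g v; apply: finfuncE => t; exact: qE.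
- move=> i; apply: map_fin_surj => m; have [v <-] := ps m.
  by exists (fsingle [tuple] v).
- move=> j z; have [f <-] := map_fin_surj qs z.
  by exists (fsingle [tuple] f).
- move=> i j; apply: map_fin_exact => v; exact: (boundary_exact eHP).
- move=> i; apply: map_fin_exact => v pv.
  have [x xE] := pk _ pv; exists x; apply: (etrans xE).
  exact: fsingle_nil.
- move=> i j; exact: (boundary_exact (fin_trace_decomposition eGP)).
- move=> j x qx.
  have [_ _ /(_ _ qx)[y yE]] := @fin_coinvariant_quotient R G (j.-tuple H) NG W q qG.
  exists y; apply: (etrans yE).
  exact: fsingle_nil.
Qed.
End WithCoinvariants.

Section Coinvariants.

Let B : {linear chain NG 1 -> chain NG 0} := @boundary R G NG 0.
Let Z : {linear chain NG 0 -> chain NG 0} := \0.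
Let W0 : lmodType R := subquotient B Z.

Fact coinv_ker (x : chain NG 0) : x \in ker_pred Z.
Proof. by rewrite inE. Qed.

Let q (v : N) : W0 := \pi_(subquotient B Z) (Kernel (coinv_ker (fsingle [tuple] v))).

Fact coinv_q_linear : linear q.
Proof.
move=> r x y; rewrite /q -pi_subquotient_linear; congr (\pi_(subquotient B Z) _).
by apply: val_inj; rewrite /= linearP.
Qed.
HB.instance Definition _ := GRing.isLinear.Build R N W0 *:%R q coinv_q_linear.

Fact coinv_q0 v : q v = 0 <-> exists x : chain NG 1, boundary x = fsingle [tuple] v.
Proof. exact: pi_subquotient_eq0. Qed.

Let coinv_repr (w : W0) : N := kernel_val (repr (w : subquotient B Z)) [tuple].

Fact coinv_reprK w : q (coinv_repr w) = w.
Proof.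
rewrite -[RHS]reprK /q /coinv_repr; congr (\pi_(subquotient B Z) _).
by apply: val_inj; exact: fsingle_nil.
Qed.

Fact coinv_q_act0 h v : q v = 0 -> q (aH h v) = 0.
Proof.
move=> /coinv_q0[x xv]; apply/coinv_q0.
pose f : {linear NG -> NG} := (aH h : {linear N -> N}).
exists (map_fin f x); rewrite boundary_map_fin; last first.
  by move=> g w; exact/esym/aGH.
by rewrite xv map_fin_single.
Qed.

Fact coinv_q_act h v v' : q v = q v' -> q (aH h v) = q (aH h v').
Proof.
move=> /eqP; rewrite -subr_eq0 -raddfB => /eqP /coinv_q_act0-/(_ h).
by rewrite !raddfB => /eqP; rewrite subr_eq0 => /eqP.
Qed.

Let aW h (w : W0) : W0 := q (aH h (coinv_repr w)).

Fact coinvariants_actE h v : aW h (q v) = q (aH h v).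
Proof. by apply: coinv_q_act; rewrite coinv_reprK. Qed.

Fact coinvariants_act_linear h : linear (aW h).
Proof.
move=> r x y; rewrite -(coinv_reprK x) -(coinv_reprK y) -linearP !coinvariants_actE.
by rewrite linearP linearP.
Qed.

Fact coinvariants_act1 w : aW 1%g w = w.
Proof. by rewrite /aW aH1 coinv_reprK. Qed.

Fact coinvariants_actM g h w : aW (g * h)%g w = aW g (aW h w).
Proof. by rewrite {3}/aW coinvariants_actE /aW aHM. Qed.

Let W : gmodule R H :=
  GModule coinvariants_act_linear coinvariants_act1 coinvariants_actM.

Lemma coinvariants_exist : exists (W : gmodule R H) (q : {linear N -> W}),
  @equivariant R H NH W q /\ @coinvariant_quotient R G NG W q.
Proof.
exists W, (q : {linear N -> W0}); split.
  by move=> h v; exact/esym/coinvariants_actE.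
split; last by move=> v /coinv_q0.
- move=> g v; apply/eqP; rewrite -subr_eq0 -raddfB; apply/eqP/coinv_q0.
  (* Coefficients are acted on through inverses, so face 0 of v at (g^-1) is g.v and the boundary is
     g.v - v. *)
  exists (fsingle [tuple of [:: g^-1%g]] v).
  rewrite boundary_single 2!big_ord_recl big_ord0 addr0 expr0 scale1r expr1 scaleN1r.
  rewrite ![face _ _]tuple0 /face_elt /= theadE invgK invg1.
  by rewrite aG1 -raddfB.
- by move=> w; exists (coinv_repr w); exact: coinv_reprK.
Qed.

End Coinvariants.

Theorem nonzero_homology_transfer (eG eH : {linear N -> N})
    (M : gmodule R G) (p : {linear N -> M}) n :
    @trace_decomposition R G NG eG -> @trace_decomposition R H NH eH ->
    @equivariant R G NG M p -> @coinvariant_quotient R H NH M p ->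
  nonzero_module (group_homology M n) ->
  exists W : gmodule R H, nonzero_module (group_homology W n).
Proof.
move=> eGP eHP pG pH /nonzero_homologyP Mn.
have [W [q [qH qG]]] := coinvariants_exist.
exists W; apply/nonzero_homologyP; apply: contra_not Mn.
exact: (homology_transfer eGP eHP pG pH qH qG).
Qed.

End HomologyTransfer.

(** * Cohomology of modules over two commuting groups *)

Section RelativelyInjective.
Variables (R : comPzRingType) (G : groupType) (V : gmodule R G).
Variable T : {linear (G -> V) -> V}.

(* T is a G-equivariant retraction of the embedding of V into the module of
   functions from G to V that sends a vector to a constant function. *)
Definition coinduced_retraction : Prop :=
  (forall v, T (fun=> v) = v) /\
  (forall g f, gmod_act g (T f) = T (fun k => gmod_act g (f (g^-1 * k)%g))).

Hypothesis TV : coinduced_retraction.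

(** The twist by k and k^-1 turns the face 0 term k^-1.f(u) of the coboundary at (k^-1, u) into the
    constant function f(u), which T retracts to f(u). *)
Definition cocone n (f : cochain V n.+1) : cochain V n :=
  fun u => T (fun k => gmod_act k (f [tuple of k^-1%g :: u])).

Lemma retraction_sum (I : Type) (s : seq I) (F : I -> G -> V) :
  T (fun k => \sum_(i <- s) F i k) = \sum_(i <- s) T (F i).
Proof. by rewrite -linear_sum; congr (T _); apply/funext => k; rewrite fct_sumE. Qed.

Lemma retractionZ r (F : G -> V) : T (fun k => r *: F k) = r *: T F.
Proof. by rewrite -linearZ. Qed.

Lemma retractionD (F F' : G -> V) : T (fun k => F k + F' k) = T F + T F'.
Proof. by rewrite -raddfD. Qed.

Lemma coboundary_cocone n (f : cochain V n.+1) :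
  coboundary (cocone f) + cocone (coboundary f) = f.
Proof.
have [Tc Ta] := TV; apply/funext => u.
rewrite -[LHS]/(coboundary (cocone f) u + cocone (coboundary f) u).
pose F (i : 'I_n.+1) k := gmod_act k (f [tuple of k^-1%g :: face (lift ord0 i) u]).
pose F0 k := gmod_act k (f [tuple of (k^-1 * thead u)%g :: face ord0 u]).
(* Equivariance of T substitutes g_1^-1 k for k, so that the face 0 term here becomes the face 1
   term of [cocone (coboundary f)]. *)
have -> : coboundary (cocone f) u =
    T F0 + \sum_(i < n.+1) (-1) ^+ i.+1 *: T (F i).
  rewrite coboundary_face big_ord_recl expr0 scale1r /face_elt /= Ta.
  congr (_ + _).
    congr (T _); apply/funext => k.
    by rewrite -gmod_actM mulVKg invgM invgK.
  by apply: eq_bigr => i _; rewrite gmod_act1.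
have -> : cocone (coboundary f) u =
    f u - T F0 + \sum_(i < n.+1) (-1) ^+ i.+2 *: T (F i).
  rewrite -(Tc (f u)) -scaleN1r -retractionZ -retractionD /cocone.
  under eq_bigr => i _ do rewrite -retractionZ.
  rewrite -retraction_sum -retractionD; congr (T _); apply/funext => k.
  rewrite coboundary_face 2!big_ord_recl face0_cons face1_cons /face_elt /=.
  rewrite thead_cons expr0 scale1r expr1 gmod_act1 !raddfD /= -gmod_actM mulgV.
  rewrite gmod_act1 addrA linearZ /=; congr (_ + _ + _).
  rewrite linear_sum /=; apply: eq_bigr => i _.
  by rewrite linearZ /= gmod_act1 faceSS_cons.
rewrite addrACA [T F0 + _]addrCA subrr addr0 -big_split /= big1 ?addr0// => i _.
by rewrite [(-1) ^+ i.+2]exprS mulN1r scaleNr subrr.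
Qed.

Lemma coboundary_exact n (f : cochain V n.+1) :
  coboundary f = 0 -> exists x, coboundary x = f.
Proof.
move=> f0; exists (cocone f); rewrite -[RHS]coboundary_cocone f0.
rewrite [X in _ + X](_ : _ = 0) ?addr0//; apply/funext => u.
rewrite /cocone (_ : (fun k => _) = 0) ?raddf0//.
by apply/funext => k; exact: gmod_act0.
Qed.

End RelativelyInjective.

Section FunGModule.
Variables (R : comPzRingType) (G : groupType) (T : Type).

Section PostComposition.
Variables (V W : lmodType R) (f : {linear V -> W}).

Definition postcomp (x : T -> V) : T -> W := f \o x.

Lemma postcomp_linear : linear postcomp.
Proof. by move=> r x y; apply/funext => t; exact: linearP. Qed.
HB.instance Definition _ :=
  GRing.isLinear.Build R (T -> V) (T -> W) *:%R postcomp postcomp_linear.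

End PostComposition.

Section ConstantFunctions.
Variable V : lmodType R.

Definition constant_fun (v : V) : T -> V := fun=> v.

Lemma constant_fun_linear : linear constant_fun.
Proof. by []. Qed.
HB.instance Definition _ :=
  GRing.isLinear.Build R V (T -> V) *:%R constant_fun constant_fun_linear.

End ConstantFunctions.

Variable V : gmodule R G.

Lemma fun_act_linear (g : G) : linear (postcomp (@gmod_act R G V g)).
Proof. exact: linearP. Qed.

Lemma fun_act1 (f : T -> V) : postcomp (@gmod_act R G V 1%g) f = f.
Proof. by apply/funext => t; exact: gmod_act1. Qed.

Lemma fun_actM (g h : G) (f : T -> V) :
  postcomp (@gmod_act R G V (g * h)%g) f =
  postcomp (@gmod_act R G V g) (postcomp (@gmod_act R G V h) f).
Proof. by apply/funext => t; exact: gmod_actM. Qed.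

Definition fun_gmodule : gmodule R G := GModule fun_act_linear fun_act1 fun_actM.

Section Retraction.
Variable r : {linear (G -> V) -> V}.

Definition fun_retraction (f : G -> fun_gmodule) : fun_gmodule :=
  fun t => r (fun k => f k t).

Lemma fun_retraction_linear : linear fun_retraction.
Proof. move=> a x y; apply/funext => t.
exact: (linearP r a (fun k => x k t) (fun k => y k t)). Qed.
HB.instance Definition _ :=
  GRing.isLinear.Build R (G -> fun_gmodule) fun_gmodule *:%R
    fun_retraction fun_retraction_linear.

Lemma fun_coinduced_retraction :
  coinduced_retraction r -> coinduced_retraction fun_retraction.
Proof.
move=> [rc ra]; split=> [v|g f]; apply/funext => t; first exact: rc.
exact: ra.
Qed.

End Retraction.

End FunGModule.

Definition invariant_submodule (R : comPzRingType) (G : groupType)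
    (V : gmodule R G) (M : lmodType R) (p : {linear M -> V}) : Prop :=
  [/\ forall g m, gmod_act g (p m) = p m, forall m, p m = 0 -> m = 0 &
      forall v, (forall g, gmod_act g v = v) -> exists m, p m = v].

Lemma coboundary0 (R : comPzRingType) (G : groupType) (V : gmodule R G)
    (f : cochain V 0) u :
  coboundary f u = gmod_act (thead u) (f [tuple]) - f [tuple].
Proof.
rewrite coboundary_face 2!big_ord_recl big_ord0 addr0 expr0 scale1r expr1 scaleN1r.
by rewrite /face_elt /= gmod_act1 ![face _ _]tuple0.
Qed.

Section CohomologyTransfer.
Variables (R : comPzRingType) (G H : groupType) (N : lmodType R).
Variables (aG : G -> N -> N) (aH : H -> N -> N).
Hypothesis aG_linear : forall g, linear (aG g).
Hypothesis aG1 : forall v, aG 1%g v = v.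
Hypothesis aGM : forall g h v, aG (g * h)%g v = aG g (aG h v).
Hypothesis aH_linear : forall h, linear (aH h).
Hypothesis aH1 : forall v, aH 1%g v = v.
Hypothesis aHM : forall g h v, aH (g * h)%g v = aH g (aH h v).
Hypothesis aGH : forall g h v, aG g (aH h v) = aH h (aG g v).

HB.instance Definition _ g := GRing.isLinear.Build R N N *:%R (aG g) (aG_linear g).
HB.instance Definition _ h := GRing.isLinear.Build R N N *:%R (aH h) (aH_linear h).

Let NG : gmodule R G := GModule aG_linear aG1 aGM.
Let NH : gmodule R H := GModule aH_linear aH1 aHM.

Section WithInvariants.
Variables (rG : {linear (G -> N) -> N}) (rH : {linear (H -> N) -> N}).
Hypothesis rGP : @coinduced_retraction R G NG rG.
Hypothesis rHP : @coinduced_retraction R H NH rH.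
Variables (M : gmodule R G) (p : {linear M -> N}).
Hypothesis pG : @equivariant R G M NG p.
Hypothesis pH : @invariant_submodule R H NH M p.
Variables (W : gmodule R H) (q : {linear W -> N}).
Hypothesis qH : @equivariant R H W NH q.
Hypothesis qG : @invariant_submodule R G NG W q.

Let V j : gmodule R G := fun_gmodule (j.-tuple H) NG.
Let C i j := cochain (V j) i.

Let d2_ i j : {linear C i j -> C i j.+1} :=
  @postcomp R (i.-tuple G) _ _ (@coboundary R H NH j).
Let p_ i : {linear cochain M i -> C i 0} :=
  @postcomp R (i.-tuple G) _ _ (@constant_fun R (0.-tuple H) N \o p).
Let q_ j : {linear cochain W j -> C 0 j} :=
  @constant_fun R (0.-tuple G) (V j) \o @postcomp R (j.-tuple H) _ _ q.

Lemma cohomology_transfer n :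
  (forall z : cochain W n, coboundary z = 0 ->
    edge_boundary (D := fun i => cochain W i) (fun i => @coboundary R H W i) z) ->
  (forall z : cochain M n, coboundary z = 0 ->
    edge_boundary (D := fun i => cochain M i) (fun i => @coboundary R G M i) z).
Proof.
have [pE p0 pk] := pH; have [qE q0 qk] := qG.
apply: (@double_complex_cohomology (fun i j => C i j) (fun i => cochain M i)
  (fun j => cochain W j) (fun i j => @coboundary R G (V j) i) (fun i j => d2_ i j)
  (fun i => @coboundary R G M i) (fun j => @coboundary R H W j)
  (fun i => p_ i) (fun j => q_ j)).
- move=> i j x; apply: (@coboundary_comp R G (V j) (V j.+1)) => g v.
  pose f : {linear NH -> NH} := (aG g : {linear N -> N}).
  have fE : @equivariant R H NH NH f by move=> h w; exact: aGH.
  exact: (@coboundary_comp R H NH NH j f v fE).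
- by move=> i j x; exact: coboundary_coboundary.
- by move=> i j x; apply/funext => u; exact: (@coboundary_coboundary R H NH).
- move=> i x; apply: (@coboundary_comp R G M (V 0%N)) => g v.
  by apply/funext => t; exact: pG.
- move=> j x; apply/funext => t; apply: (@coboundary_comp R H W NH) => h v.
  exact: qH.
- move=> i x; apply/funext => u; apply/funext => t.
  apply: etrans (@coboundary0 R H NH _ _) _.
  by rewrite [X in X - _]pE subrr.
- move=> j x; apply/funext => u.
  apply: etrans (@coboundary0 R G (V j) _ _) _.
  apply/eqP; rewrite subr_eq0; apply/eqP/funext => t; exact: qE.
- move=> i x px; apply/funext => u; apply: p0.
  exact: (congr1 (fun y : C i 0 => y u [tuple]) px).
- move=> j x qx; apply/funext => u; apply: q0.
  exact: (congr1 (fun y : C 0 j => y [tuple] u) qx).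
- move=> i j x dx.
  have /choice[y yP] : forall u, exists y, @coboundary R H NH j y = x u.
    move=> u; apply: (coboundary_exact rHP).
    exact: (congr1 (fun z : C i j.+2 => z u) dx).
  by exists y; apply/funext => u; exact: yP.
- move=> i x dx.
  have /choice[y yP] : forall u, exists m, p m = x u [tuple].
    move=> u; apply: pk => h; apply/eqP; rewrite -subr_eq0; apply/eqP.
    have := congr1 (fun z : C i 1 => z u [tuple of [:: h]]) dx.
    exact: etrans (esym (@coboundary0 R H NH _ _)).
  exists y; apply/funext => u; apply/funext => t.
  by rewrite (tuple0 t); exact: yP.
- move=> i j; have rP := @fun_coinduced_retraction R G (j.-tuple H) NG rG rGP.
  exact: (@coboundary_exact R G (V j) _ rP i).
- move=> j x dx.
  have /choice[y yP] : forall u, exists m, q m = x [tuple] u.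
    move=> u; apply: qk => g; apply/eqP; rewrite -subr_eq0; apply/eqP.
    have := congr1 (fun z : C 1 j => z [tuple of [:: g]] u) dx.
    exact: etrans (congr1 (@^~ u) (esym (@coboundary0 R G (V j) _ _))).
  exists y; apply/funext => t; apply/funext => u.
  by rewrite (tuple0 t); exact: yP.
Qed.

End WithInvariants.

Section Invariants.

(** Its kernel is N^G, which thereby inherits the R-module structure of [kernel]. *)
Let D (v : N) : G -> N := fun g => aG g v - v.

Fact invariants_D_linear : linear D.
Proof.
move=> r x y; apply/funext => g; rewrite /D linearP.
by rewrite -[RHS]/(r *: (aG g x - x) + (aG g y - y)) scalerBr opprD addrACA.
Qed.
HB.instance Definition _ :=
  GRing.isLinear.Build R N (G -> N) *:%R D invariants_D_linear.

Fact invariants_kerP v : v \in ker_pred D <-> forall g, aG g v = v.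
Proof.
rewrite inE; split=> [Dv g|vE].
  apply/eqP; rewrite -subr_eq0; apply/eqP.
  exact: (congr1 (fun f : G -> N => f g) Dv).
apply/funext => g; apply: etrans (subrr v); congr (_ - _); exact: vE.
Qed.

Fact invariants_act_ker h (w : kernel D) : aH h (kernel_val w) \in ker_pred D.
Proof.
apply/invariants_kerP => g; rewrite aGH.
by have /invariants_kerP -> := valP w.
Qed.

Let aW h (w : kernel D) : kernel D := Kernel (invariants_act_ker h w).

Fact invariants_act_linear h : linear (aW h).
Proof. by move=> r x y; apply: val_inj; rewrite /= linearP. Qed.

Fact invariants_act1 w : aW 1%g w = w.
Proof. by apply: val_inj; exact: aH1. Qed.

Fact invariants_actM g h w : aW (g * h)%g w = aW g (aW h w).
Proof. by apply: val_inj; exact: aHM. Qed.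

Let W : gmodule R H := GModule invariants_act_linear invariants_act1 invariants_actM.

Fact kernel_val_linear : linear (@kernel_val R N (G -> N) D).
Proof. by []. Qed.
HB.instance Definition _ := GRing.isLinear.Build R (kernel D) N *:%R
  (@kernel_val R N (G -> N) D) kernel_val_linear.

Lemma invariants_exist : exists (W : gmodule R H) (q : {linear W -> N}),
  @equivariant R H W NH q /\ @invariant_submodule R G NG W q.
Proof.
exists W, (@kernel_val R N (G -> N) D : {linear kernel D -> N}); split=> //.
split.
- by move=> g w; have /invariants_kerP := valP w; apply.
- by move=> w w0; apply: val_inj.
- by move=> v /invariants_kerP vD; exists (Kernel vD).
Qed.

End Invariants.

Theorem nonzero_cohomology_transfer
    (rG : {linear (G -> N) -> N}) (rH : {linear (H -> N) -> N})
    (M : gmodule R G) (p : {linear M -> N}) n :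
    @coinduced_retraction R G NG rG -> @coinduced_retraction R H NH rH ->
    @equivariant R G M NG p -> @invariant_submodule R H NH M p ->
  nonzero_module (group_cohomology M n) ->
  exists W : gmodule R H, nonzero_module (group_cohomology W n).
Proof.
move=> rGP rHP pG pH /nonzero_cohomologyP Mn.
have [W [q [qH qG]]] := invariants_exist.
exists W; apply/nonzero_cohomologyP; apply: contra_not Mn.
exact: (cohomology_transfer rGP rHP pG pH qH qG).
Qed.

End CohomologyTransfer.

(** * Orbit cocycles *)

Definition locally_constant (X : topologicalType) (T : Type) (f : X -> T) : Prop :=
  forall x, \forall y \near x, f y = f x.

Lemma continuous_locally_constant (X : topologicalType) (T : choiceType)
    (f : X -> discrete_topology T) :
  continuous f -> @locally_constant X T f.
Proof.
by move=> fc x; exact: (fc x _ (discrete_set1 (f x))).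
Qed.

Lemma locally_constant_comp (X Y : topologicalType) (T : Type) (f : Y -> T)
    (p : X -> Y) :
  continuous p -> locally_constant f -> locally_constant (f \o p).
Proof. by move=> pc fl x; exact: (pc x _ (fl (p x))). Qed.

Lemma tds_actKV (G : groupType) (X : tds G) (g : G) (x : X) :
  tds_act g^-1%g (tds_act g x) = x.
Proof. by rewrite -tds_actM mulVg tds_act1. Qed.

Lemma tds_actVK (G : groupType) (X : tds G) (g : G) (x : X) :
  tds_act g (tds_act g^-1%g x) = x.
Proof. by rewrite -tds_actM mulgV tds_act1. Qed.

Lemma near_tds_act (G : groupType) (X : tds G) (g : G) (x : X) (P : set X) :
  (\forall y \near x, P (tds_act g y)) -> \forall y \near tds_act g x, P y.
Proof.
move=> Px; have gc := @tds_act_continuous _ X g^-1%g (tds_act g x).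
have : nbhs (tds_act g x) (tds_act g^-1%g @^-1` [set y | P (tds_act g y)]).
  by apply: (gc); rewrite tds_actKV.
by apply: filterS => y /=; rewrite tds_actVK.
Qed.

Lemma free_near (G : groupType) (X : tds G) (t : G) (x : X) :
  topologically_free X -> (\forall y \near x, tds_act t y = y) -> t = 1%g.
Proof.
move=> Xf tx; apply: contrapT => /Xf /(_ ([set y | tds_act t y = y]^°)).
case; [by exists x; exact: tx|exact: open_interior|].
by move=> y [/interior_subset /= ty /=]; rewrite ty.
Qed.

Section OrbitCocycles.
Variables (G H : groupType) (c : orbit_couple G H).
Hypothesis cfree : topologically_free_couple c.
Let X := oc_X c.
Let Y := oc_Y c.
Let p := @oc_p _ _ c.
Let q := @oc_q _ _ c.

(** The group being discrete, joint continuity of the cocycle yields local constancy in x for each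
    fixed group element. *)
Lemma orbit_map_cocycle (G' H' : groupType) (X' : tds G') (Y' : tds H')
    (f : X' -> Y') : continuous_orbit_map f ->
  continuous f /\ exists a : G' -> X' -> H', (forall g, locally_constant (a g)) /\
    forall g x, f (tds_act g x) = tds_act (a g x) (f x).
Proof.
move=> [fc [a [ac aE]]]; split=> //; exists (fun g x => a (g, x)); split=> // g.
apply: continuous_locally_constant => x.
have gx : (fun y : X' => ((g : discrete_topology G'), y)) @ x -->
    (g : discrete_topology G', x).
  move=> A [[P Q] [/= Pg Qx] PQ]; rewrite /nbhs /=; apply: filterS Qx => y Qy.
  by apply: PQ; split=> //=; exact: nbhs_singleton Pg.
exact: (cvg_trans (cvg_app a gx) (ac (g, x))).
Qed.

Lemma orbit_map_free (t : H) (x : X) :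
  (\forall y \near x, tds_act t (p y) = p y) -> t = 1%g.
Proof.
move=> tx.
have [pc [a [al aE]]] := orbit_map_cocycle (oc_p_orbit c).
have [qc _] := oc_q_orbit c.
have [g [_ gE]] := oc_qp c; have [h [hc hE]] := oc_pq c.
have hl := continuous_locally_constant hc.
(* Conjugating by the cocycle moves the hypothesis from x to g(x).x = q(p(x)), a point in the image
   of q. *)
pose t1 := (a (g x) x * t * (a (g x) x)^-1)%g.
have t1P : \forall y \near q (p x), tds_act t1 (p y) = p y.
  rewrite /q /p gE; apply: near_tds_act; apply: filterS2 tx (al (g x) x) => y ty ay.
  by rewrite /p aE ay /t1 !tds_actM tds_actKV [tds_act t _]ty.
(* Near p(x), p(q(y)) is h(p(x)).y with a fixed group element; now a whole neighbourhood in Y is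
   fixed and freeness of Y applies. *)
have t2P : \forall y \near p x, tds_act ((h (p x))^-1 * t1 * h (p x))%g y = y.
  have := qc _ _ t1P; rewrite /nbhs /=; apply: filterS2 (hl (p x)) => y hy /= ty.
  by have := ty; rewrite /p hE hy !tds_actM => ->; rewrite tds_actKV.
have /(congr1 (fun u => h (p x) * u * (h (p x))^-1)%g) := free_near cfree.2 t2P.
rewrite mulg1 mulgV !mulgA mulgV mul1g mulgK.
move=> /(congr1 (fun u => (a (g x) x)^-1 * u * (a (g x) x))%g).
by rewrite mulg1 mulVg /t1 !mulgA mulVg mul1g mulgVK.
Qed.

(** In each identity the two sides act alike on nearby points, so their quotient is 1: by
    [orbit_map_free] for [a], by freeness of X for [d]. *)
Lemma orbit_couple_cocycles : exists (a : G -> X -> H) (d : H -> X -> G),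
  [/\ forall g, locally_constant (a g),
      forall g g' x, a (g * g')%g x = (a g (tds_act g' x) * a g' x)%g,
      forall h, locally_constant (d h) &
      forall g h x, d (a g x * h)%g (tds_act g x) = (g * d h x)%g].
Proof.
have [pc [a [al aE]]] := orbit_map_cocycle (oc_p_orbit c).
have [qc [b [bl bE]]] := orbit_map_cocycle (oc_q_orbit c).
have [g0 [gc gE]] := oc_qp c; have gl := continuous_locally_constant gc.
(* Inverse of the element carrying x first to q(p(x)), then to q(h^-1.p(x)). *)
pose d h x := ((b h^-1 (p x) * g0 x)^-1)%g.
have dl h : locally_constant (d h).
  move=> x; have := locally_constant_comp pc (bl h^-1%g) x.
  by apply: filterS2 (gl x) => y /= gy b_y; rewrite /d gy b_y.
have dE h x : tds_act (d h x) (q (tds_act h^-1%g (p x))) = x.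
  by rewrite /q /p bE gE /d -[tds_act (b _ _) _]tds_actM tds_actKV.
exists a, d; split=> // [g g' x|g h x].
  have : ((a (g * g') x)^-1 * (a g (tds_act g' x) * a g' x) = 1)%g.
    apply: (@orbit_map_free _ x).
    have lg := locally_constant_comp (@tds_act_continuous _ X g') (al g) x.
    (* Local constancy moves all group elements from x to the nearby point y, where the orbit map
       equations evaluate them. *)
    near=> y.
    have -> : a (g * g')%g x = a (g * g')%g y by apply/esym; near: y; exact: al.
    have -> : a g' x = a g' y by apply/esym; near: y; exact: al.
    have -> : a g (tds_act g' x) = a g (tds_act g' y) by apply/esym; near: y; exact: lg.
    rewrite !tds_actM /p -!aE -tds_actM aE.
    exact: tds_actKV.
  by move=> /(congr1 (fun u => a (g * g')%g x * u)%g); rewrite mulg1 mulVKg.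
have : ((d h x)^-1 * (g^-1 * d (a g x * h)%g (tds_act g x)) = 1)%g.
  have lg := locally_constant_comp (@tds_act_continuous _ X g) (dl (a g x * h)%g) x.
  have : \forall y \near x,
      tds_act (g^-1 * d (a g x * h)%g (tds_act g x) * (d h x)^-1)%g y = y.
    near=> y.
    have -> : d (a g x * h)%g (tds_act g x) = d (a g x * h)%g (tds_act g y).
      by apply/esym; near: y; exact: lg.
    have -> : d h x = d h y by apply/esym; near: y; exact: dl.
    have -> : a g x = a g y by apply/esym; near: y; exact: al.
    have -> y' : tds_act (g^-1 * d (a g y' * h)%g (tds_act g y') * (d h y')^-1)%g y' =
        tds_act g^-1%g (tds_act (d (a g y' * h)%g (tds_act g y'))
          (q (tds_act h^-1%g (p y')))).
      by rewrite !tds_actM -{4}(dE h y') tds_actKV.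
    (* This is the invariance of q(h^-1.p(y)) under the action of G on (y, h). *)
    have <- : tds_act (a g y * h)^-1%g (p (tds_act g y)) = tds_act h^-1%g (p y).
      by rewrite /p aE -tds_actM invgM mulgVK.
    by rewrite dE tds_actKV.
  move=> /(free_near cfree.1) /(congr1 (fun u => (d h x)^-1 * u * d h x)%g).
  by rewrite mulg1 mulVg !mulgA mulgVK.
move=> /(congr1 (fun u => g * (d h x * u))%g).
by rewrite mulVKg mulVKg mulg1.
Unshelve. all: end_near. Qed.

End OrbitCocycles.

(** * Sections over X x H *)

Lemma compact_finite_image (X : topologicalType) (T : Type) (c : X -> T) (K : set X) :
  compact K -> locally_constant c -> finite_set (c @` K).
Proof.
move=> /compact_near_coveringP Kc cl.
(* For this filter of eventually large sets S, [S (c x)] holds eventually and locally uniformly in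
   x; compactness yields one finite S for all of K. *)
pose F (Q : set (set T)) := exists2 S0, finite_set S0 & forall S, S0 `<=` S -> Q S.
have FF : Filter F.
  split; first by exists set0.
    move=> P Q [S Sf SP] [S' Sf' SQ]; exists (S `|` S'); first by rewrite finite_setU.
    by move=> U; rewrite subUset => -[/SP ? /SQ ?].
  by move=> P Q PQ [S Sf SP]; exists S => // U /SP /PQ.
have [|S0 S0f /(_ S0 (@subset_refl _ S0)) KS0] := Kc _ F (fun S x => S (c x)) FF.
  move=> x Kx; exists ([set y | c y = c x], [set S | S (c x)]) => /=.
    split; first exact: cl.
    by exists [set c x] => [|S]; [exact: finite_set1|apply].
  by move=> [y S] /= [-> ].
by apply: sub_finite_set S0f => _ [x Kx <-]; exact: KS0.
Qed.

Section GluingSections.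
Variables (R : comPzRingType) (G : groupType) (X : tds G) (A : gsheaf R X).

Lemma glue_subproof (T : Type) (c : X -> T) (s : T -> section A) :
  locally_constant c -> (fun x => s (c x) x) \in @section_pred R G X A.
Proof.
move=> cl; apply/asboolP; split=> x; last exact: sectionK.
apply: (@cvg_trans _ (s (c x) @ x)); last exact: section_continuous.
by apply: near_eq_cvg; apply: filterS (cl x) => y ->.
Qed.

(** Pasting along the clopen level sets of [c]: with [c] from [a] it gives the G-action on N, with
    [c] from [d] the retraction and the cut-off for G. *)
Definition glue (T : Type) (c : X -> T) (cl : locally_constant c)
  (s : T -> section A) : section A := Section_ (glue_subproof s cl).

Lemma glue_linear (T : Type) (c : X -> T) (cl : locally_constant c) :
  linear (glue cl).
Proof. by move=> r s t; apply: section_ext. Qed.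

Lemma section_sum_eq0 (I : eqType) (S : seq I) (s : I -> section A) x :
  (forall i, i \in S -> s i x = sh_zero A x) ->
  (\sum_(i <- S) s i) x = sh_zero A x.
Proof.
move=> s0; rewrite big_seq; elim/big_ind : _ => // u v ux vx.
by rewrite /= ux vx -{1}(sh_pi_zero A x) sh_add0.
Qed.

Lemma section_sum_eq (I : Type) (S : seq I) (s t : I -> section A) x :
  (forall i, s i x = t i x) -> (\sum_(i <- S) s i) x = (\sum_(i <- S) t i) x.
Proof.
by move=> st; elim/big_ind2 : _ => // u u' v v' /= -> ->.
Qed.

Lemma section_sum_single (I : eqType) (S : seq I) (s : I -> section A) x i0 :
    uniq S -> i0 \in S -> (forall i, i != i0 -> s i x = sh_zero A x) ->
  (\sum_(i <- S) s i) x = s i0 x.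
Proof.
move=> uS i0S s0; rewrite (bigD1_seq i0) //= -big_filter.
rewrite section_sum_eq0 => [|i]; last by rewrite mem_filter => /andP[/s0].
rewrite sh_addC ?sectionK ?sh_pi_zero//.
by have := sh_add0 (s i0 x); rewrite sectionK.
Qed.

Lemma section_act_eq0 g (s : section A) x :
  s (tds_act g^-1%g x) = sh_zero A (tds_act g^-1%g x) ->
  section_act g s x = sh_zero A x.
Proof.
move=> sx; have : section_act g 0 x = sh_zero A x.
  by have /(congr1 (fun u : section A => u x)) := gmod_act0 (Gamma A) g.
by rewrite /= sx.
Qed.

End GluingSections.

Section BibundleModule.
Variables (R : comPzRingType) (G H : groupType) (X : tds G).
Variables (a : G -> X -> H) (d : H -> X -> G).
Hypothesis al : forall g, locally_constant (a g).
Hypothesis aM : forall g g' x, a (g * g')%g x = (a g (tds_act g' x) * a g' x)%g.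
Hypothesis dl : forall h, locally_constant (d h).
Hypothesis dE : forall g h x, d (a g x * h)%g (tds_act g x) = (g * d h x)%g.
Variable A : gsheaf R X.

Let N : lmodType R := H -> section A.

Lemma cocycle1 x : a 1%g x = 1%g.
Proof.
have := aM 1%g 1%g x; rewrite mulg1 tds_act1 => /(congr1 (fun u => (a 1 x)^-1 * u)%g).
by rewrite mulVg mulKg.
Qed.

Fact al_translate g h : locally_constant (fun x => a g x * h)%g.
Proof. by move=> x; apply: filterS (al g x) => y ->. Qed.

(* The space underlying these modules is X x H, with the commuting actions
   g.(x, h) = (g.x, a(g, x) h) and k.(x, h) = (x, h k^-1). *)
Definition bundle_actG g (F : N) : N :=
  fun h => glue (@al_translate g^-1%g h) (fun k => section_act g (F k)).

Definition bundle_actH k (F : N) : N := fun h => F (h * k)%g.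

Lemma bundle_actG_linear g : linear (bundle_actG g).
Proof.
move=> r F F'; apply/funext => h.
apply: etrans (glue_linear (@al_translate g^-1%g h) r _ _); congr (glue _ _).
by apply/funext => k; exact: section_act_linear.
Qed.

Lemma bundle_actG1 F : bundle_actG 1%g F = F.
Proof.
apply/funext => h; apply: section_ext => x /=.
by rewrite invg1 cocycle1 mul1g tds_act1 sh_act1.
Qed.

Lemma bundle_actGM g g' F : bundle_actG (g * g')%g F = bundle_actG g (bundle_actG g' F).
Proof.
apply/funext => h; apply: section_ext => x /=.
by rewrite invgM aM tds_actM sh_actM mulgA.
Qed.

Lemma bundle_actH_linear k : linear (bundle_actH k).
Proof. by []. Qed.

Lemma bundle_actH1 F : bundle_actH 1%g F = F.
Proof. by apply/funext => h; rewrite /bundle_actH mulg1. Qed.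

Lemma bundle_actHM k k' F : bundle_actH (k * k')%g F = bundle_actH k (bundle_actH k' F).
Proof. by apply/funext => h; rewrite /bundle_actH mulgA. Qed.

Lemma bundle_actGH g k F :
  bundle_actG g (bundle_actH k F) = bundle_actH k (bundle_actG g F).
Proof.
by apply/funext => h; apply: section_ext => x /=; rewrite /bundle_actH /= mulgA.
Qed.

(** * All sections over X x H *)

Section Cohomology.

Let NG : gmodule R G := GModule bundle_actG_linear bundle_actG1 bundle_actGM.
Let NH : gmodule R H := GModule bundle_actH_linear bundle_actH1 bundle_actHM.

(** In terms of points z = (x, h), this is z -> f(d(z))(z); its equivariance is d(g.z) = g d(z). *)
Definition bundle_retG (f : G -> N) : N := fun h => glue (dl h) (fun k => f k h).

Lemma bundle_retG_linear : linear bundle_retG.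
Proof. by move=> r f f'; apply/funext => h; exact: glue_linear. Qed.
HB.instance Definition _ :=
  GRing.isLinear.Build R (G -> N) N *:%R bundle_retG bundle_retG_linear.

Lemma bundle_retGP : @coinduced_retraction R G NG bundle_retG.
Proof.
split=> [F|g f]; apply/funext => h; apply: section_ext => x //=.
by rewrite dE.
Qed.

(** The same construction for H: as k sends (x, h) to (x, h k^-1), the equivariant map to H is (x,
    h) -> h^-1. *)
Definition bundle_retH (f : H -> N) : N := fun h => f h^-1%g h.

Lemma bundle_retH_linear : linear bundle_retH.
Proof. by []. Qed.
HB.instance Definition _ :=
  GRing.isLinear.Build R (H -> N) N *:%R bundle_retH bundle_retH_linear.

Lemma bundle_retHP : @coinduced_retraction R H NH bundle_retH.
Proof.
split=> [F|k f]; apply/funext => h //.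
by rewrite /= /bundle_actH /bundle_retH invgM.
Qed.

Lemma bundle_constant_equivariant :
  @equivariant R G (Gamma A) NG (@constant_fun R H (section A)).
Proof. by move=> g s; apply/funext => h; apply: section_ext. Qed.

Lemma bundle_constant_invariant :
  @invariant_submodule R H NH (Gamma A) (@constant_fun R H (section A)).
Proof.
split=> [k s|s s0|F FE] //; first exact: (congr1 (fun f : N => f 1%g) s0).
exists (F 1%g); apply/funext => h.
have := congr1 (fun f : N => f 1%g) (FE h).
by rewrite /= /bundle_actH mul1g.
Qed.

Theorem sections_cohomology_transfer n :
  nonzero_module (group_cohomology (Gamma A) n) ->
  exists W : gmodule R H, nonzero_module (group_cohomology W n).
Proof.
exact: (nonzero_cohomology_transfer bundle_actGH bundle_retGP bundle_retHP
  bundle_constant_equivariant bundle_constant_invariant).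
Qed.

End Cohomology.

(** * Compactly supported sections over X x H *)

Section Homology.

Definition fc_pred : {pred N} :=
  [pred F : N | `[< exists S (K : set X), [/\ finite_set S, compact K &
     forall h x, F h x <> sh_zero A x -> S h /\ K x] >]].

Lemma fc_pred_closed : submod_closed fc_pred.
Proof.
split=> [|r F F' /asboolP[S [K [Sf Kc FSK]]] /asboolP[S' [K' [Sf' Kc' FSK']]]];
  apply/asboolP.
  by exists set0, set0; split=> //; exact: compact0.
exists (S `|` S'), (K `|` K'); split; first by rewrite finite_setU.
  exact: compactU.
move=> h x FF'.
have [F0|] := pselect (F h x = sh_zero A x); last by case/FSK => Sh Kx; split; left.
have [F'0|] := pselect (F' h x = sh_zero A x); last by case/FSK' => Sh Kx; split; right.
case: FF'; have -> : (r *: F + F') h x = (r *: F h + F' h) x by [].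
have r0 : sh_scale r (sh_zero A x) = sh_zero A x.
  by have := congr1 (fun u : section A => u x) (scaler0 (section A) r).
by rewrite /= F0 F'0 r0 -{1}(sh_pi_zero A x) sh_add0.
Qed.
HB.instance Definition _ := GRing.isSubmodClosed.Build R N fc_pred
  (GRing.submod_closed_semi fc_pred_closed).

(* Such an F is a section over X x H, where H is discrete; membership in fc_pred
   says that its support is contained in a compact set. *)
Record fcfun := FcFun { fcfun_val :> H -> section A; _ : fcfun_val \in fc_pred }.
HB.instance Definition _ := [isSub for fcfun_val].
HB.instance Definition _ := [Choice of fcfun by <:].
HB.instance Definition _ := [SubChoice_isSubLmodule of fcfun by <:].

Lemma fcfunP (F : fcfun) : exists S (K : set X), [/\ finite_set S, compact K &
     forall h x, F h x <> sh_zero A x -> S h /\ K x].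
Proof. by have /asboolP := valP F. Qed.

Lemma fcfun_ext (F F' : fcfun) : (forall h x, F h x = F' h x) -> F = F'.
Proof.
by move=> FF'; apply: val_inj; apply/funext => h; apply: section_ext => x; exact: FF'.
Qed.

Lemma fc_actG_subproof g (F : fcfun) : bundle_actG g F \in fc_pred.
Proof.
apply/asboolP; have [S [K [Sf Kc FSK]]] := fcfunP F.
pose gK := tds_act g @` K.
have gKc : compact gK.
  apply: continuous_compact => //; apply: continuous_subspaceT.
  exact: tds_act_continuous.
(* The translation of the H-coordinate varies with x, but takes finitely many values over the
   compact [gK]. *)
exists [set ((u^-1 * k)%g) | u in (a g^-1%g @` gK) & k in S], gK; split=> //.
  by apply: finite_image2 => //; exact: compact_finite_image.
move=> h x /= gF.
have [|Sh Kx] := FSK (a g^-1%g x * h)%g (tds_act g^-1%g x).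
  by move=> F0; apply: gF; exact: (section_act_eq0 F0).
have gKx : gK x by exists (tds_act g^-1%g x) => //; rewrite tds_actVK.
split=> //; exists (a g^-1%g x); first by exists x.
by exists (a g^-1%g x * h)%g => //; rewrite mulKg.
Qed.
Definition fc_actG g F := FcFun (fc_actG_subproof g F).

Lemma fc_actH_subproof k (F : fcfun) : bundle_actH k F \in fc_pred.
Proof.
apply/asboolP; have [S [K [Sf Kc FSK]]] := fcfunP F.
exists [set (h * k^-1)%g | h in S], K; split=> //; first exact: finite_image.
move=> h x /FSK[Sh Kx]; split=> //; exists (h * k)%g => //.
by rewrite mulgK.
Qed.
Definition fc_actH k F := FcFun (fc_actH_subproof k F).

Lemma fc_actG_linear g : linear (fc_actG g).
Proof. by move=> r F F'; apply: val_inj; exact: bundle_actG_linear. Qed.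

Lemma fc_actG1 F : fc_actG 1%g F = F.
Proof. by apply: val_inj; exact: bundle_actG1. Qed.

Lemma fc_actGM g g' F : fc_actG (g * g')%g F = fc_actG g (fc_actG g' F).
Proof. by apply: val_inj; exact: bundle_actGM. Qed.

Lemma fc_actH_linear k : linear (fc_actH k).
Proof. by move=> r F F'; apply: val_inj; exact: bundle_actH_linear. Qed.

Lemma fc_actH1 F : fc_actH 1%g F = F.
Proof. by apply: val_inj; exact: bundle_actH1. Qed.

Lemma fc_actHM k k' F : fc_actH (k * k')%g F = fc_actH k (fc_actH k' F).
Proof. by apply: val_inj; exact: bundle_actHM. Qed.

Lemma fc_actGH g k F : fc_actG g (fc_actH k F) = fc_actH k (fc_actG g F).
Proof. by apply: val_inj; exact: bundle_actGH. Qed.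

Let NG : gmodule R G := GModule fc_actG_linear fc_actG1 fc_actGM.
Let NH : gmodule R H := GModule fc_actH_linear fc_actH1 fc_actHM.

Lemma fc_shrink (F : fcfun) (F' : N) :
  (forall h x, F' h x <> sh_zero A x -> F h x <> sh_zero A x) -> F' \in fc_pred.
Proof.
move=> FF'; apply/asboolP; have [S [K [Sf Kc FSK]]] := fcfunP F.
by exists S, K; split=> // h x /FF' /FSK.
Qed.

Lemma fc_cutG_subproof (F : fcfun) :
  (fun h => glue (dl h) (fun k => if k == 1%g then F h else 0)) \in fc_pred.
Proof. by apply: (@fc_shrink F) => h x /=; case: eqP. Qed.
(** The set d = 1 is a clopen fundamental domain for the action of G on X x H. *)
Definition fc_cutG F := FcFun (fc_cutG_subproof F).

Lemma fc_cutG_linear : linear fc_cutG.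
Proof.
move=> r F F'; apply: val_inj; apply/funext => h.
apply: etrans (glue_linear (dl h) r _ _); congr (glue _ _).
apply/funext => k; rewrite -[RHS]/(r *: (if k == 1%g then F h else 0) +
  (if k == 1%g then F' h else 0)).
by case: eqP => // _; rewrite scaler0 addr0.
Qed.
HB.instance Definition _ :=
  GRing.isLinear.Build R fcfun fcfun *:%R fc_cutG fc_cutG_linear.

Lemma fc_cutH_subproof (F : fcfun) :
  (fun h => if h == 1%g then F h else 0) \in fc_pred.
Proof. by apply: (@fc_shrink F) => h x /=; case: eqP. Qed.
Definition fc_cutH F := FcFun (fc_cutH_subproof F).

Lemma fc_cutH_linear : linear fc_cutH.
Proof.
move=> r F F'; apply: val_inj; apply/funext => h /=.
rewrite -[RHS]/(r *: (if h == 1%g then F h else 0) + (if h == 1%g then F' h else 0)).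
by case: eqP => // _; rewrite scaler0 addr0.
Qed.
HB.instance Definition _ :=
  GRing.isLinear.Build R fcfun fcfun *:%R fc_cutH fc_cutH_linear.

Definition fc_at (h : H) (F : fcfun) : section A := F h.

Lemma fc_at_linear h : linear (fc_at h).
Proof. by []. Qed.
HB.instance Definition _ h :=
  GRing.isLinear.Build R fcfun (section A) *:%R (fc_at h) (fc_at_linear h).

(* If the k-th conjugate of e is the restriction to a piece of a partition of
   X x H into clopen sets indexed by K, then these conjugates sum up to 1. *)
Lemma trace_decomposition_partition (K : groupType)
    (aK : K -> fcfun -> fcfun) (aK_linear : forall k, linear (aK k))
    (aK1 : forall F, aK 1%g F = F)
    (aKM : forall k k' F, aK (k * k')%g F = aK k (aK k' F))
    (e : {linear fcfun -> fcfun}) (c : H -> X -> K) :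
    (forall h, locally_constant (c h)) ->
    (forall k F h x, aK k^-1%g (e (aK k F)) h x =
       if k == c h x then F h x else sh_zero A x) ->
  @trace_decomposition R K (GModule aK_linear aK1 aKM) e.
Proof.
move=> cl ce F; have [S [C [Sf Cc FSC]]] := fcfunP F.
pose D := \bigcup_(h in S) (c h @` C).
have Df : finite_set D.
  by apply: bigcup_finite => // h _; exact: compact_finite_image.
have eD k : e (aK k F) <> 0 -> D k.
  move=> ek; apply: contrapT => kD; apply: ek.
  suff eF0 : aK k^-1%g (e (aK k F)) = 0.
    rewrite -[LHS]aK1 -(mulgV k) aKM eF0.
    exact: (@gmod_act0 R K (GModule aK_linear aK1 aKM)).
  apply: fcfun_ext => h x; rewrite ce; case: eqP => // kc.
  apply: contrapT => /FSC[Sh Cx]; apply: kD; exists h => //.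
  by exists x.
exists (fset_set D); split; first exact: fset_uniq.
  by move=> k /eD kD; rewrite in_fset_set// inE.
apply: fcfun_ext => h x; rewrite -[LHS]/((fc_at h _) x) linear_sum /=.
have [cD|cD] := pselect (D (c h x)).
  rewrite (@section_sum_single _ _ _ _ _ _ _ _ (c h x)).
  - by rewrite /fc_at /= ce eqxx.
  - exact: fset_uniq.
  - by rewrite in_fset_set// inE.
  - by move=> k /negbTE kc; rewrite /fc_at /= ce kc.
rewrite section_sum_eq0 => [|k]; last first.
  rewrite in_fset_set// inE => kD; rewrite /fc_at /= ce.
  by case: eqP => // kc; rewrite -kc in cD.
apply/esym; apply: contrapT => /FSC[Sh Cx]; apply: cD.
by exists h => //; exists x.
Qed.

Lemma fc_cutG_trace : @trace_decomposition R G NG fc_cutG.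
Proof.
(* The k-th conjugate restricts to the points z with d(k.z) = k d(z) = 1, hence the inverse. *)
apply: (@trace_decomposition_partition _ _ _ _ _ _ (fun h x => (d h x)^-1%g)).
  by move=> h x; apply: filterS (dl h x) => y ->.
move=> k F h x /=.
rewrite invgK dE -(inj_eq (@invg_inj G)) invgK -[1%g](mulgV k) (inj_eq (@mulgI _ k)).
rewrite eq_sym; case: eqP => kd; last first.
  by have := @section_act_eq0 _ _ _ A k^-1%g 0 x erefl; rewrite /= invgK.
have := congr1 (fun u : fcfun => u h x) (fc_actGM k^-1%g k F).
by rewrite mulVg fc_actG1 /= invgK => ->.
Qed.

Lemma fc_cutH_trace : @trace_decomposition R H NH fc_cutH.
Proof.
apply: (@trace_decomposition_partition _ _ _ _ _ _ (fun h x => h)) => [h x|k F h x].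
  by apply: filterE.
rewrite /= /bundle_actH /= -[1%g](mulgV k) (inj_eq (@mulIg _ k^-1%g)) eq_sym.
by case: eqP => // <-; rewrite mulgVK.
Qed.


Lemma fc_finite_support (F : fcfun) : finite_set [set h | F h <> 0].
Proof.
have [S [K [Sf Kc FSK]]] := fcfunP F; apply: sub_finite_set Sf => h Fh.
apply: contrapT => Sh; apply: Fh; apply: section_ext => x.
by apply: contrapT => /FSK[].
Qed.

Definition fc_sum_section (F : fcfun) : section A :=
  \sum_(h <- fset_set [set h | F h <> 0]) F h.

Lemma fc_sum_sectionE (F : fcfun) (S : seq H) :
    uniq S -> (forall h, F h <> 0 -> h \in S) ->
  fc_sum_section F = \sum_(h <- S) F h.
Proof.
move=> uS FS; apply: eq_big_support => //.
by move=> h Fh; rewrite in_fset_set ?inE//; exact: fc_finite_support.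
Qed.

Lemma fc_support_seq (F : fcfun) :
  exists S : seq H, forall h, F h <> 0 -> h \in S.
Proof.
exists (fset_set [set h | F h <> 0]) => h Fh.
by rewrite in_fset_set ?inE//; exact: fc_finite_support.
Qed.

Lemma fc_sum_subproof (F : fcfun) : fc_sum_section F \in @csection_pred R G X A.
Proof.
have [S [K [Sf Kc FSK]]] := fcfunP F.
apply: rpred_sum => h _; apply/asboolP.
apply: (subclosed_compact _ Kc); first exact: closed_closure.
have /closure_id -> : closed K by apply: compact_closed => //; exact: tds_hausdorff.
by apply: closureS => x /= /FSK[].
Qed.

Definition fc_sum (F : fcfun) : csection A := CSection (fc_sum_subproof F).

Lemma fc_sum_linear : linear fc_sum.
Proof.
move=> r F F'; apply: val_inj.
have [S FS] := fc_support_seq F; have [S' FS'] := fc_support_seq F'.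
rewrite -[RHS]/(r *: fc_sum_section F + fc_sum_section F').
pose T := undup (S ++ S'); have uT : uniq T := undup_uniq _.
rewrite [LHS](@fc_sum_sectionE _ T)// => [|h].
  rewrite (@fc_sum_sectionE F T)// => [|h /FS hS]; last first.
    by rewrite mem_undup mem_cat hS.
  rewrite (@fc_sum_sectionE F' T)// => [|h /FS' hS]; last first.
    by rewrite mem_undup mem_cat hS orbT.
  by rewrite scaler_sumr -big_split.
move=> FFh; rewrite mem_undup mem_cat.
have [//|Sh] := boolP (h \in S); have [//|Sh'] /= := boolP (h \in S').
case: FFh; rewrite -[LHS]/(r *: F h + F' h).
have -> : F h = 0 by apply: contrapT => /FS; rewrite (negbTE Sh).
have -> : F' h = 0 by apply: contrapT => /FS'; rewrite (negbTE Sh').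
by rewrite scaler0 addr0.
Qed.
HB.instance Definition _ :=
  GRing.isLinear.Build R fcfun (csection A) *:%R fc_sum fc_sum_linear.

Lemma fc_sum_equivariant : @equivariant R G NG (Gamma_c A) fc_sum.
Proof.
move=> g F; apply: val_inj; apply: section_ext => x.
rewrite -[LHS]/(fc_sum_section (fc_actG g F) x).
rewrite -[RHS]/(section_act g (fc_sum_section F) x).
have [S FS] := fc_support_seq (fc_actG g F); have [S' FS'] := fc_support_seq F.
(* The action of G shifts the fibre over x by [u], which depends on x; the two sums are therefore
   compared point by point. *)
set u := a g^-1%g x.
pose T := undup (S ++ [seq (u^-1 * h)%g | h <- S']).
have uT : uniq T := undup_uniq _.
rewrite (@fc_sum_sectionE _ T)// => [|h /FS hS]; last by rewrite mem_undup mem_cat hS.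
rewrite (@fc_sum_sectionE F [seq (u * h)%g | h <- T]); last 2 first.
- by rewrite map_inj_uniq//; exact: mulgI.
- move=> h /FS' hS; apply/mapP; exists (u^-1 * h)%g; last by rewrite mulVKg.
  by rewrite mem_undup mem_cat map_f ?orbT.
rewrite big_map -[section_act g _]/(@gmod_act R G (Gamma A) g _) linear_sum.
exact: section_sum_eq.
Qed.

Lemma fc_sum_actH k (F : fcfun) : fc_sum (fc_actH k F) = fc_sum F.
Proof.
apply: val_inj; have [S FS] := fc_support_seq F.
rewrite -[LHS]/(fc_sum_section (fc_actH k F)) -[RHS]/(fc_sum_section F).
rewrite (@fc_sum_sectionE F (undup S)) ?undup_uniq// => [|h /FS]; last first.
  by rewrite mem_undup.
rewrite (@fc_sum_sectionE _ [seq (h * k^-1)%g | h <- undup S]).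
- by rewrite big_map; apply: eq_bigr => h _; rewrite /= /bundle_actH mulgVK.
- by rewrite map_inj_uniq ?undup_uniq//; exact: mulIg.
move=> h /FS hS; apply/mapP; exists (h * k)%g; last by rewrite mulgK.
by rewrite mem_undup.
Qed.

(** A preimage of [s] under [fc_sum], placed on the sheet h = 1. *)
Lemma fc_supported_at1 (s : csection A) :
  (fun h : H => if h == 1%g then csection_val s else 0) \in fc_pred.
Proof.
apply/asboolP; exists [set 1%g], (closure [set x | s x <> sh_zero A x]).
split; [exact: finite_set1|by have /asboolP := valP s|].
move=> h x; case: eqP => // -> sx; split=> //.
exact: subset_closure.
Qed.

Lemma fc_sum_coinvariant : @coinvariant_quotient R H NH (Gamma_c A) fc_sum.
Proof.
split=> [k F|s|F F0]; first exact: fc_sum_actH.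
  exists (FcFun (fc_supported_at1 s)); apply: val_inj.
  rewrite -[LHS]/(fc_sum_section _) (@fc_sum_sectionE _ [:: 1%g])// => [|h].
    by rewrite big_seq1 /= eqxx.
  by rewrite inE /=; case: eqP.
(* The sum of the cut-offs of k.F is [fc_sum F] on the sheet h = 1 and 0 on the others, so the
   degree 0 criterion follows from [fc_sum F = 0]. *)
apply: (boundary_exact0 fc_cutH_trace) => S uS HS.
apply: val_inj; apply/funext => h.
rewrite -[LHS]/(fc_at h _) linear_sum /=.
have [->|h1] := eqVneq h 1%g; last first.
  exact: big1.
apply: (@etrans _ _ (fc_sum_section F)); last first.
  exact: (congr1 (@csection_val _ _ _ _) F0).
rewrite (@fc_sum_sectionE F S)// => [|k Fk].
  by apply: eq_bigr => k _; rewrite /bundle_actH mul1g.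
apply: HS => /(congr1 (fc_at 1%g)); rewrite /fc_at /= eqxx /bundle_actH mul1g.
exact: Fk.
Qed.

Theorem sections_homology_transfer n :
  nonzero_module (group_homology (Gamma_c A) n) ->
  exists W : gmodule R H, nonzero_module (group_homology W n).
Proof.
exact: (nonzero_homology_transfer fc_actGH fc_cutG_trace fc_cutH_trace
  fc_sum_equivariant fc_sum_coinvariant).
Qed.

End Homology.
End BibundleModule.

Lemma degree_sup_le (D D' : set nat) : D `<=` D' -> (degree_sup D <= degree_sup D')%E.
Proof. by move=> DD'; apply: le_ereal_sup; exact: image_subset. Qed.

Theorem corollary3p3 (R : comPzRingType) (G H : groupType)
    (countableG : countable [set: G]%classic) (countableH : countable [set: H]%classic) :
  ((exists c : orbit_couple G H,
      topologically_free_couple c /\ homology_full R c) ->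
    (hd R G <= hd R H)%E) /\
  ((exists c : orbit_couple G H,
      topologically_free_couple c /\ cohomology_full R c) ->
    (cd R G <= cd R H)%E).
Proof.
split=> -[c [cfree cfull]]; have [a [d [al aM dl dE]]] := orbit_couple_cocycles cfree.
  rewrite -cfull; apply: degree_sup_le => n [A].
  exact: (sections_homology_transfer al aM dl dE).
rewrite -cfull; apply: degree_sup_le => n [A].
exact: (sections_cohomology_transfer al aM dl dE).
Qed.
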